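(* Let $p$ be an odd prime, let $L/K$ be a separable field extension of degree $2p$, let $\widetilde{L}/K$ be its normal closure and $G\simeq \mathrm{Gal}(\widetilde{L}/K)$. Then $L/K$ has a Hopf Galois structure of cyclic type (i.e. of type $C_{2p}$) if and only if $G$ is isomorphic to either (i) the semidirect product $C_{2p}\rtimes C_m$ of a cyclic group of order $2p$ and a cyclic group of order $m$ dividing $p-1$; or (ii) the semidirect product $C_p\rtimes C_m$ of a cyclic group of order $p$ and a cyclic group of even order $m$ dividing $p-1$. In these cases the number of Hopf Galois structures of cyclic type on $L/K$ is $1$, except in case (ii) for $m=2$, when this number is $p$. In this last case, $G$ is isomorphic to the dihedral group $D_{2p}$ of order $2p$.
   Context: A Hopf Galois structure on a finite field extension $L/K$ is a pair $(H,\mu)$, where $H$ is a finite cocommutative $K$-Hopf algebra and $\mu: H\to \operatorname{End}_K(L)$ is a $K$-linear map giving $L$ a left $H$-module algebra structure and inducing a $K$-vector space isomorphism $L\otimes_K H\to \operatorname{End}_K(L)$. Hopf Galois structures are counted up to isomorphism (a $K$-Hopf algebra isomorphism compatible with the actions). Let $L/K$ be separable of degree $g$, $\widetilde{L}$ its Galois closure, $G=\mathrm{Gal}(\widetilde{L}/K)$, $G'=\mathrm{Gal}(\widetilde{L}/L)$, and let $\lambda:G\hookrightarrow S_g=\mathrm{Sym}(G/G')$ be given by the action of $G$ on the left cosets $G/G'$. By the Greither–Pareigis theorem, Hopf Galois structures on $L/K$ are in bijection with regular subgroups $N$ of $S_g$ normalized by $\lambda(G)$; the Hopf algebra corresponding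 to $N$ is $\widetilde{L}[N]^G$, where $G$ acts on $\widetilde{L}$ by $K$-automorphisms and on $N$ by conjugation through $\lambda$. The type of a Hopf Galois structure is the isomorphism class of the corresponding group $N$. $C_n$ denotes the cyclic group of order $n$. The semidirect products are those with faithful action, i.e. $C_m$ acts as the unique subgroup of order $m$ of the cyclic group $\mathrm{Aut}(C_{2p})$, respectively $\mathrm{Aut}(C_p)$, each of order $p-1$. *)

(* Defs.v *)
From HB Require Import structures.
From mathcomp Require Import all_boot all_order all_fingroup all_algebra.
From mathcomp Require Import all_solvable all_field.

Set Implicit Arguments.
Unset Strict Implicit.
Unset Printing Implicit Defensive.

Import GroupScope GRing.Theory VectorInternalTheory.
Local Open Scope ring_scope.

(* Tensor product of finite-dimensional spaces, modelled by matrices of       *)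
(* coordinates with respect to the bases underlying [v2r].                    *)
(* [tens_lift_pure] and [tens_lift_id] give the universal property: for a     *)
(* bilinear [f], [tens_lift f] is the unique linear map with                  *)
(* v (x) w |-> f v w.  Thus [tens_lift (fun a b => E a b) t] reads, in        *)
(* Sweedler notation, "sum of E(t_(1), t_(2))".                               *)
Definition tens (K : fieldType) (V W : vectType K) : vectType K :=
  'M[K]_(dim V, dim W).

Definition pure (K : fieldType) (V W : vectType K) (v : V) (w : W) :
  tens V W := (v2r v)^T *m v2r w.

Definition tens_lift (K : fieldType) (V W : vectType K) (U : lmodType K)
    (f : V -> W -> U) (t : tens V W) : U :=
  \sum_(i < dim V) \sum_(j < dim W)
    (t : 'M_(_, _)) i j *: f (r2v (delta_mx 0 i)) (r2v (delta_mx 0 j)).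

Lemma tens_lift_is_linear (K : fieldType) (V W : vectType K) (U : lmodType K)
  (f : V -> W -> U) : linear (tens_lift f).
Proof.
move=> a s t; rewrite /tens_lift scaler_sumr -big_split; apply: eq_bigr => i _.
rewrite scaler_sumr -big_split; apply: eq_bigr => j _ /=.
by rewrite !mxE scalerDl scalerA.
Qed.

Lemma v2r_basis (K : fieldType) (V : vectType K) (v : V) :
  v = \sum_(i < dim V) v2r v 0 i *: r2v (delta_mx 0 i).
Proof.
apply: (can_inj v2rK); rewrite linear_sum {1}[v2r v]row_sum_delta.
by apply: eq_bigr => i _; rewrite linearZ /= r2vK.
Qed.

Lemma tens_lift_pure (K : fieldType) (V W : vectType K) (U : lmodType K)
    (f : V -> W -> U) (v : V) (w : W) :
  (forall y, linear (f^~ y)) -> (forall x, linear (f x)) ->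
  tens_lift f (pure v w) = f v w.
Proof.
move=> fl fr.
pose l y := GRing.isLinear.Build _ _ _ _ (f^~ y) (fl y).
pose r x := GRing.isLinear.Build _ _ _ _ (f x) (fr x).
pose L y : {linear V -> U} := HB.pack (f^~ y) (l y).
pose R x : {linear W -> U} := HB.pack (f x) (r x).
have -> : f v w = L w v by [].
rewrite [v in RHS]v2r_basis linear_sum; apply: eq_bigr => i _.
rewrite linearZ /=.
set x := r2v _; have -> : f x w = R x w by [].
rewrite [w in RHS]v2r_basis linear_sum scaler_sumr; apply: eq_bigr => j _.
by rewrite linearZ scalerA !mxE big_ord1 mxE.
Qed.

Lemma tens_lift_id (K : fieldType) (V W : vectType K) (t : tens V W) :
  tens_lift (@pure K V W) t = t.
Proof.
rewrite [RHS](matrix_sum_delta (t : 'M_(_, _))).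
apply: eq_bigr => i _; apply: eq_bigr => j _.
by rewrite /pure !r2vK trmx_delta mul_delta_mx.
Qed.

Definition tens_map (K : fieldType) (V W V' W' : vectType K)
    (f : V -> V') (g : W -> W') : tens V W -> tens V' W' :=
  tens_lift (fun v w => pure (f v) (g w)).

Definition tens_mul (K : fieldType) (A B : falgType K) (s t : tens A B) :
    tens A B :=
  tens_lift (fun a b => tens_lift (fun c d => pure (a * c) (b * d)) t) s.

Definition tens_assoc (K : fieldType) (U V W : vectType K) :
    tens U (tens V W) -> tens (tens U V) W :=
  tens_lift (fun u => tens_lift (fun v w => pure (pure u v) w)).

Record hopfAlgebra (K : fieldType) := HopfAlgebra {
  hopf_sort :> falgType K;
  comul : 'Hom(hopf_sort, tens hopf_sort hopf_sort);
  counit : 'Hom(hopf_sort, K^o);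
  antipode : 'End(hopf_sort);
  comul1 : comul 1 = pure 1 1;
  comulM : forall a b, comul (a * b) = tens_mul (comul a) (comul b);
  counit1 : counit 1 = 1;
  counitM : forall a b, counit (a * b) = counit a * counit b;
  comulA : forall a,
    tens_assoc (tens_map id comul (comul a)) = tens_map comul id (comul a);
  comul_counitl : forall a, tens_lift (fun b c => counit b *: c) (comul a) = a;
  comul_counitr : forall a, tens_lift (fun b c => counit c *: b) (comul a) = a;
  antipodel : forall a,
    tens_lift (fun b c => antipode b * c) (comul a) = counit a *: 1;
  antipoder : forall a,
    tens_lift (fun b c => b * antipode c) (comul a) = counit a *: 1
}.

Definition cocommutative (K : fieldType) (H : hopfAlgebra K) : Prop :=
  forall a : H, tens_lift (fun b c => pure c b) (comul H a) = comul H a.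

Definition hopf_iso (K : fieldType) (H H' : hopfAlgebra K)
    (f : 'Hom(H, H')) : Prop :=
  [/\ bijective f,
      f 1 = 1 /\ (forall a b, f (a * b) = f a * f b),
      forall a, comul H' (f a) = tens_map f f (comul H a),
      forall a, counit H' (f a) = counit H a
    & forall a, antipode H' (f a) = f (antipode H a)].

Record hopfGalois (K : fieldType) (L : fieldExtType K) := HopfGalois {
  hg_hopf : hopfAlgebra K;
  hg_act : 'Hom(hg_hopf, 'End(L));
  hg_cocomm : cocommutative hg_hopf;
  hg_act1 : forall x, hg_act 1 x = x;
  hg_actM : forall a b x, hg_act (a * b) x = hg_act a (hg_act b x);
  hg_one : forall a, hg_act a 1 = counit hg_hopf a *: 1;
  hg_mul : forall a x y,
    hg_act a (x * y)
      = tens_lift (fun b c => hg_act b x * hg_act c y) (comul hg_hopf a);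
  (* x (x) a |-> (y |-> x * (a . y)) *)
  hg_galois : bijective (tens_lift (fun (x : L) (a : hg_hopf) =>
                linfun (fun y : L => x * hg_act a y)))
}.

Definition hg_iso (K : fieldType) (L : fieldExtType K)
    (X Y : hopfGalois L) : Prop :=
  exists2 f : 'Hom(hg_hopf X, hg_hopf Y),
    hopf_iso f & forall a x, hg_act Y (f a) x = hg_act X a x.

Definition card_upto (T : Type) (P : T -> Prop) (R : T -> T -> Prop)
    (n : nat) : Prop :=
  exists s : 'I_n -> T,
    [/\ forall i, P (s i),
        forall i j, R (s i) (s j) -> i = j
      & forall x, P x -> exists i, R x (s i)].

(* [M] is normal over [K] because it is a [splittingFieldType]. *)
Definition is_normal_closure (K : fieldType) (M : splittingFieldType K)
    (L : {subfield M}) : Prop :=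
  forall E : {subfield M}, (L <= E)%VS -> normalField 1 E -> (E : {vspace M}) = {:M}%VS.

Section GreitherPareigis.

Variables (K : fieldType) (M : splittingFieldType K) (L : {subfield M}).

Local Notation G := 'Gal({:M} / 1).
Local Notation G' := 'Gal({:M} / L).

(* In [gal_of] and in [{perm _}] the product [a * b] is "a, then b", i.e. the *)
(* composite usually written b o a.  Hence the left coset g o G' is the set   *)
(* [G' :* g], the left translation gamma o (g o G') is [(G' :* g) :* gamma],  *)
(* and gamma o n o gamma^-1 is [n ^ gamma].                                   *)
Definition galCoset := {A : {set gal_of {:M}} | A \in rcosets G' G}.

Lemma gal_full (g : gal_of {:M}) : g \in G.
Proof. by rewrite gal_kHom ?sub1v ?k1AHom. Qed.

Lemma galCoset_one_subproof : (G' : {set _}) \in rcosets G' G.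
Proof. by apply/rcosetsP; exists 1%g; rewrite ?group1 ?mulg1. Qed.

Definition galCoset_one : galCoset := exist _ (G' : {set _}) galCoset_one_subproof.

Lemma galCoset_mul_subproof (g : gal_of {:M}) (A : galCoset) :
  val A :* g \in rcosets G' G.
Proof.
case: A => A /= /rcosetsP[h hG ->]; apply/rcosetsP; exists (h * g)%g.
  exact: gal_full.
by rewrite rcosetM.
Qed.

Definition galCoset_mul (g : gal_of {:M}) (A : galCoset) : galCoset :=
  exist _ (val A :* g) (galCoset_mul_subproof g A).

Lemma galCoset_mul_inj (g : gal_of {:M}) : injective (galCoset_mul g).
Proof. by move=> A B /(congr1 val) /= /rcoset_inj /val_inj. Qed.

Definition lambda (g : gal_of {:M}) : {perm galCoset} :=
  perm (@galCoset_mul_inj g).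

(* The K-embedding x |-> g(x) of [L] into [M] attached to g o G'.             *)
Definition galCoset_emb (A : galCoset) (x : subvs_of L) : M :=
  repr (val A) (val x).

Definition regular_subgroup (N : {group {perm galCoset}}) : Prop :=
  [transitive N, on [set: galCoset] | 'P] /\
  (forall A : galCoset, 'C_N[A | 'P] = 1%g).

Definition lambda_normalized (N : {group {perm galCoset}}) : Prop :=
  (lambda @: G \subset 'N(N))%g.

(* M[N] is the set of functions supported on [N], [u] standing for            *)
(* sum_n u(n) n; below, the product is that of the composition of             *)
(* permutations.                                                              *)
Definition grpRing := {ffun {perm galCoset} -> M}.

Definition grpRing_mul (u v : grpRing) : grpRing :=
  [ffun n => \sum_a \sum_(b | (b * a)%g == n) u a * v b].

Definition grpRing_one : grpRing := [ffun n => (n == 1%g)%:R].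

(* M[N]^G, for gamma . (c n) = gamma(c) (lambda(gamma) n lambda(gamma)^-1).   *)
Definition in_descent (N : {group {perm galCoset}}) (u : grpRing) : Prop :=
  (forall n, n \notin N -> u n = 0) /\
  (forall g, g \in G -> forall n, n \in N -> u (n ^ lambda g)%g = g (u n)).

(* [X] is isomorphic to M[N]^G with its Hopf algebra structure induced from   *)
(* the one of M[N] (for which N is group-like) and with the action            *)
(*   (sum_n c_n n) . x = sum_n c_n (n^-1 (G'))(x),                            *)
(* [phi] being the isomorphism composed with the inclusion in M[N].           *)
(* The comultiplication is compared inside M[N] (x)_M M[N] = M[N x N], in     *)
(* which M[N]^G (x)_K M[N]^G embeds.                                          *)
Definition gp_corresponds (N : {group {perm galCoset}})
    (X : hopfGalois (subvs_of L)) : Prop :=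
  exists phi : {linear hg_hopf X -> grpRing},
  [/\ injective phi /\ (forall u, in_descent N u <-> exists a, phi a = u),
      phi 1 = grpRing_one /\
        (forall a b, phi (a * b) = grpRing_mul (phi a) (phi b)),
      (forall a n n',
         tens_lift (fun b c => phi b n * phi c n') (comul (hg_hopf X) a)
           = if n == n' then phi a n else 0) /\
        (forall a, \sum_n phi a n = (counit (hg_hopf X) a : K) *: (1 : M)),
      forall a n, phi (antipode (hg_hopf X) a) n = phi a n^-1%g
    & forall a x,
        val (hg_act X a x)
          = \sum_n phi a n * galCoset_emb (n^-1%g galCoset_one) x].

Definition has_type (X : hopfGalois (subvs_of L)) (gT : finGroupType)
    (T : {group gT}) : Prop :=
  exists N : {group {perm galCoset}},
    [/\ regular_subgroup N, lambda_normalized N, gp_corresponds N X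
      & N \isog T].

End GreitherPareigis.

(* Isomorphic to a semidirect product C_n x| C_m with faithful action.        *)
Definition is_faithful_cyclic_sdprod (gT : finGroupType) (G : {group gT})
    (n m : nat) : Prop :=
  exists A B : {group gT},
    [/\ A ><| B = G, A \isog Zp n, B \isog Zp m & 'C_B(A) = 1%g].

(* Main.v *)
Require Import Defs.
From HB Require Import structures.
From mathcomp Require Import all_boot all_order all_fingroup all_algebra.
From mathcomp Require Import all_solvable all_field.

Set Implicit Arguments.
Unset Strict Implicit.
Unset Printing Implicit Defensive.

Import GroupScope.

(** The statement splits into a correspondence and a count.

    Correspondence.  Hopf Galois structures of cyclic type are matched with the
    cyclic regular subgroups N of Sym(G/G') normalized by [lambda G], where G'
    is the group of [M/L].
    Everything rests on two facts about the functions on a finite set that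
    commute with a Galois action: they span all functions over [M], by
    Dedekind's independence of automorphisms ([descent_spans]), and families of
    them that are free over [K] stay free over [M], by taking traces
    ([equivariant_free]).  Hence M[N]^G has dimension #|N| over [K], and a
    tensor of two of its elements is the same thing as an equivariant function
    on N x N ([tens_eval_inj], [descent_tensor_surj]).  The comultiplication is
    the function supported on the diagonal, each Hopf algebra axiom becomes an
    identity between finite sums, and every N carries a structure
    ([descent_corresponds]).  Two structures attached to the same N are
    isomorphic, because both embed in M[N] with the same image
    ([gp_corresponds_iso]).  Conversely an isomorphism determines N
    ([gp_corresponds_inj]): the embeddings of [L] into [M] being independent,
    the coefficients of an element are read off its action on [L], so that the
    coefficient at n of N must be the one at the n' of N' that moves the base
    point in the same way; as M[N]^G spans M[N], the matching n |-> n' is a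
    group isomorphism, and then n and n' agree as permutations.

    Count.  Let Gamma be a transitive group of degree 2p, and N = C x <z> a
    cyclic regular group normalized by Gamma, with C of order p and z of order
    2.  An element of order p of Gamma acts trivially on N since Aut N has order
    p - 1, so it lies in the self-centralizing group N, and C is contained in
    Gamma; and z commutes with Gamma ([cyclic_regular_struct]).  Moreover
    C_Gamma(C) is contained in N, so that Gamma modulo its intersection with N
    embeds in Aut C.  According to whether z lies in Gamma this makes Gamma a
    semidirect product C_2p : C_m or C_p : C_m ([cyclic_regular_cases]).
    In the other direction, when Gamma has a normal Sylow subgroup P of order p,
    z |-> P x <z> is a bijection from the involutions of the centralizer of
    Gamma in the symmetric group to the groups N ([card_cyclic_regular]).  Such
    an involution is given by its value at one point x, that is, by an element
    of order 2 of N_Gamma(S)/S where S is the stabilizer of x.  For C_2p : C_m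
    the involution has to be that of C_2p.  For C_p : C_m, S has order m/2; if
    m > 2 then N_Gamma(S) is a conjugate of C_m and N_Gamma(S)/S has a single
    involution, while for m = 2 the group Gamma is dihedral and regular, and all
    its p involutions occur. *)

(** * Finite groups *)

Lemma isog_ZpP (gT : finGroupType) (A : {group gT}) n : 0 < n ->
  (A \isog Zp n) = cyclic A && (#|A| == n).
Proof.
move=> n0; have cZ : cyclic (Zp n).
  have [n1 | n1] := boolP (1 < n); last by rewrite /Zp (negPf n1) cyclic1.
  by rewrite /Zp n1; apply/cyclicP; exists Zp1; apply: Zp_cycle.
by rewrite isog_sym isog_cyclic_card // card_Zp.
Qed.

Section FaithfulOnPrime.

Variables (gT : finGroupType) (p : nat) (P B : {group gT}).
Hypotheses (p_pr : prime p) (oP : #|P| = p) (nPB : B \subset 'N(P)).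

(** Conjugation embeds [B] into Aut P, which is cyclic of order p - 1. *)
Lemma faithful_prime_cyclic : 'C_B(P) = 1 -> cyclic B /\ #|B| %| p.-1.
Proof.
move=> cBP; have injB : 'injm (restrm nPB (conj_aut P)).
  by rewrite ker_restrm ker_conj_aut cBP.
have cycA : cyclic (Aut P) by apply: Aut_prime_cyclic; rewrite oP.
have oA : #|Aut P| = p.-1.
  by rewrite card_Aut_cyclic ?prime_cyclic ?oP // totient_prime.
have sBA : restrm nPB (conj_aut P) @* B \subset Aut P.
  by rewrite morphim_restrm setIid; apply: Aut_conj_aut.
split; first by rewrite -(injm_cyclic injB) //; apply: cyclicS cycA.
by rewrite -oA -(card_injm injB) // cardSg.
Qed.

End FaithfulOnPrime.

(** A group normalizing a subgroup of order 2 has no room to move its generator. *)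
Lemma norm_involution_cent (gT : finGroupType) (H : {group gT}) (z : gT) :
  H \subset 'N(<[z]>) -> #[z] = 2 -> z \in 'C(H).
Proof.
move=> nzH oz; apply/centP => g gH; rewrite /commute conjgC; congr (_ * _).
have : z ^ g \in <[z]> by rewrite memJ_norm ?cycle_id ?(subsetP nzH).
by rewrite (cycle2g oz) !inE conjg_eq1 -order_eq1 oz => /eqP.
Qed.

(** [Q :\: S] is a single coset of [S].  With [b := a^-1] this says that
    squares of elements outside [S] fall in [S]. *)
Lemma index2_div (gT : finGroupType) (S Q : {group gT}) (a b : gT) :
  S \subset Q -> #|Q| = (2 * #|S|)%N -> a \in Q :\: S -> b \in Q :\: S ->
  a * b^-1 \in S.
Proof.
move=> sSQ oQ aQ /setDP[bQ bS]; rewrite -mem_rcoset.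
suffices -> : S :* b = Q :\: S by [].
apply/eqP; rewrite eqEcard card_rcoset cardsD (setIidPr sSQ) oQ mul2n -addnn addnK leqnn.
rewrite andbT; apply/subsetP => _ /rcosetP[s sS ->].
by rewrite inE groupMl // bS groupM // (subsetP sSQ).
Qed.

(** * Centralizers of transitive permutation groups *)

Section PermGroups.

Variable T : finType.
Implicit Types (N : {group {perm T}}) (n y z : {perm T}).

Lemma mem_stab N (x : T) n : (n \in 'C_N[x | 'P]) = (n \in N) && (n x == x).
Proof.
by rewrite inE; congr (_ && _); apply/astab1P/eqP; rewrite /= /aperm.
Qed.

Lemma cent_apply y n N x : y \in 'C(N) -> n \in N -> y (n x) = n (y x).
Proof. by move=> cy nN; rewrite -!permM; have /centP/(_ n nN) -> := cy. Qed.

(** An element that commutes with a transitive group propagates its value at one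
    point to all the others. *)
Lemma cent_trans_eq N y z x : [transitive N, on [set: T] | 'P] ->
  y \in 'C(N) -> z \in 'C(N) -> y x = z x -> y = z.
Proof.
move=> trN cy cz yz; apply/permP => t.
have [n nN ->] := atransP2 trN (in_setT x) (in_setT t).
by rewrite /= /aperm (cent_apply _ cy nN) (cent_apply _ cz nN) yz.
Qed.

Lemma trans_cent_abelian N : [transitive N, on [set: T] | 'P] -> abelian N ->
  'C(N) \subset N.
Proof.
move=> trN abN; apply/subsetP => y cy.
have /imsetP[x _ _] := trN.
have [n nN E] := atransP2 trN (in_setT x) (in_setT (y x)).
by rewrite (cent_trans_eq trN cy (subsetP abN n nN) E).
Qed.

(** If [n] normalizes the stabilizer of [x], then m x |-> m (n x) is well defined
    on the points m x, and it commutes with [N].  This realizes the elements of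
    the normalizer quotient of a stabilizer inside the centralizer of [N]. *)
Lemma stab_norm_cent N x n : [transitive N, on [set: T] | 'P] ->
  n \in N -> n \in 'N('C_N[x | 'P]) ->
  exists2 z, z \in 'C(N) & z x = n x.
Proof.
move=> trN nN nS.
have /fin_all_exists2[r rN rE] t : exists2 r, r \in N & t = r x.
  by apply: (atransP2 trN); rewrite in_setT.
pose f t := r t (n x).
have stabN k : k \in N -> (k (n x) == n x) = (k x == x).
  move=> kN; have -> : (k x == x) = (k \in 'C_N[x | 'P]) by rewrite mem_stab kN.
  rewrite -(memJ_norm _ (groupVr nS)) mem_stab groupJ ?groupV //= conjgE invgK !permM.
  by rewrite -(inj_eq (@perm_inj _ n^-1)) permK.
have eqN a b : a \in N -> b \in N -> (a (n x) == b (n x)) = (a x == b x).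
  move=> aN bN; have E t : (a t == b t) = ((a * b^-1) t == t).
    by rewrite permM -[RHS](inj_eq (@perm_inj _ b)) permKV.
  by rewrite !E stabN // groupM ?groupV.
have fE m : m \in N -> f (m x) = m (n x).
  by move=> mN; apply/eqP; rewrite /f eqN // -rE.
have fI : injective f.
  by move=> s t /eqP; rewrite (rE s) (rE t) !fE // eqN // => /eqP.
exists (perm fI); last by rewrite permE -[X in f X](@perm1 _ x) fE ?perm1.
apply/centP => k kN; apply/permP => t; rewrite !permM !permE (rE t) -permM.
by rewrite !fE ?groupM // permM.
Qed.

End PermGroups.

(** * Cyclic regular subgroups in degree 2p *)

Section DegreeTwoP.

Variables (T : finType) (p : nat) (G : {group {perm T}}).
Hypotheses (p_pr : prime p) (p_odd : odd p) (cardT : #|[set: T]| = (2 * p)%N).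
Hypothesis trG : [transitive G, on [set: T] | 'P].
Implicit Types N : {group {perm T}}.

Definition cyclic_regular N := [&& [transitive N, on [set: T] | 'P],
  [forall x, 'C_N[x | 'P] == 1], G \subset 'N(N) & cyclic N].

Definition cent_involution (z : {perm T}) := (z \in 'C(G)) && (#[z] == 2).

Lemma coprime2p : coprime 2 p. Proof. by rewrite coprime2n. Qed.

Lemma cent_fix_eq1 z x : z \in 'C(G) -> z x = x -> z = 1.
Proof. by move=> cz zx; apply: (cent_trans_eq (x := x) trG cz (group1 _)); rewrite zx perm1. Qed.

Lemma trans_card_stab N x : [transitive N, on [set: T] | 'P] ->
  #|N| = (2 * p * #|'C_N[x | 'P]|)%N.
Proof.
by move=> trN; rewrite -cardT -(atransP trN x (in_setT x)) card_orbit_stab.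
Qed.

Lemma point_exists : exists x : T, True.
Proof. by have /imsetP[x _ _] := trG; exists x. Qed.

Lemma cyclic_regular_card N : cyclic_regular N -> #|N| = (2 * p)%N.
Proof.
case/and4P=> trN /forallP freeN _ _; have [x _] := point_exists.
by rewrite (trans_card_stab x trN) (eqP (freeN x)) cards1 muln1.
Qed.

Lemma card2p_parts N : cyclic N -> #|N| = (2 * p)%N ->
  exists c z, [/\ c \in N, z \in N, #[c] = p, #[z] = 2 & N = <[c]> * <[z]> :> {set _}].
Proof.
move=> /cyclicP[x defN] oN; have ox : #[x] = (2 * p)%N by rewrite orderE -defN.
have oc : #[x ^+ 2] = p by rewrite orderXdiv ox ?dvdn_mulr // mulKn.
have oz : #[x ^+ p] = 2 by rewrite orderXdiv ox ?dvdn_mull // mulnK ?prime_gt0.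
have xN : x \in N by rewrite defN cycle_id.
exists (x ^+ 2), (x ^+ p); split; rewrite ?groupX //.
apply/esym/eqP; rewrite eqEcard mul_subG ?cycle_subG ?groupX //=.
rewrite oN coprime_cardMg -?orderE oc oz; first by rewrite mulnC.
by rewrite coprime_sym coprime2p.
Qed.

(** [N] has order 2p, hence an automorphism group of order p - 1, so the elements
    of order p of [G] centralize [N]; as [N] is abelian and transitive it
    contains them.  The subgroup of order 2 of [N] is characteristic, hence
    normalized and therefore centralized by [G]. *)
Lemma cyclic_regular_struct N : cyclic_regular N ->
  exists c z, [/\ c \in G /\ #[c] = p, cent_involution z & N = <[c]> <*> <[z]> :> {set _}].
Proof.
move=> crN; have oN := cyclic_regular_card crN.
have [trN _ nNG cycN] := and4P crN.
have [c [z [cN zN oc oz defN]]] := card2p_parts cycN oN.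
have abN := cyclic_abelian cycN.
have cNN := trans_cent_abelian trN abN.
have zG : z \in 'C(G).
  apply: norm_involution_cent oz; apply: char_norm_trans nNG.
  by rewrite sub_cyclic_char ?cycle_subG.
exists c, z; split.
- split=> //.
  have pG : p %| #|G|.
    by apply: dvdn_trans (atrans_dvd trG); rewrite cardT dvdn_mull.
  have [y yG oy] := Cauchy p_pr pG.
  have nNy : y \in 'N(N) by apply: (subsetP nNG).
  have yN : y \in N.
    apply: (subsetP cNN); rewrite -ker_conj_aut; apply/kerP => //.
    apply/eqP; rewrite -order_eq1 -dvdn1.
    (* The automorphism induced by y has order dividing both p and p - 1. *)
    have co : coprime p p.-1 by rewrite coprimenP ?prime_gt0.
    rewrite -(eqP co) dvdn_gcd -{1}oy morph_order //=.
    have -> : p.-1 = #|Aut N|.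
      by rewrite card_Aut_cyclic // oN totient_coprime ?coprime2p // !totient_prime // mul1n.
    by apply: order_dvdG; apply: Aut_aut.
  rewrite -cycle_subG (_ : <[c]> = <[y]>) ?cycle_subG //.
  by apply/eqP; rewrite (eq_subG_cyclic cycN) ?cycle_subG // -!orderE oc oy.
- by rewrite /cent_involution zG oz /=.
rewrite cent_joinEl ?defN // (subset_trans _ (centS (_ : _ \subset N))) ?cycle_subG //.
exact: subsetP abN c cN.
Qed.

Section NormalSylow.

Variable P : {group {perm T}}.
Hypotheses (oP : #|P| = p) (nsPG : P <| G) (sylP : p.-Sylow(G) P).

Lemma cyclic_of_order_p (y : {perm T}) : y \in G -> #[y] = p -> <[y]> = P.
Proof.
move=> yG oy; apply/eqP; rewrite eqEcard -orderE oy oP leqnn andbT.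
rewrite (sub_normal_Hall sylP) ?cycle_subG //.
by rewrite /pgroup -orderE oy pnat_id.
Qed.

(** The order of [G] is 2p times that of a stabilizer, and p divides it once. *)
Lemma stab_p' x : ~~ (p %| #|'C_G[x | 'P]|).
Proof.
have := trans_card_stab x trG.
rewrite -(Lagrange (normal_sub nsPG)) oP -mulnA mulnCA.
move/eqP; rewrite eqn_pmul2l ?prime_gt0 // => /eqP E.
apply/negP => pS; have [_ _] := and3P sylP; rewrite p'natE // E.
by rewrite dvdn_mull.
Qed.

Lemma cent_involution_centP z : cent_involution z -> <[z]> \subset 'C(P).
Proof.
case/andP=> zG _; rewrite cycle_subG; apply: (subsetP (centS _)) zG.
exact: normal_sub.
Qed.

Lemma join_card z : cent_involution z -> #|P <*> <[z]>| = (2 * p)%N.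
Proof.
move=> iz; rewrite norm_joinEr ?cents_norm ?cent_involution_centP //.
case/andP: iz => _ /eqP oz.
rewrite orderE in oz; rewrite coprime_cardMg oz oP 1?mulnC //.
by rewrite coprime_sym coprime2p.
Qed.

Lemma join_cyclic z : cent_involution z -> cyclic (P <*> <[z]>).
Proof.
move=> iz; rewrite norm_joinEr ?cents_norm ?cent_involution_centP //.
have cz := cent_involution_centP iz; case/andP: iz => _ /eqP oz.
rewrite cyclicM ?cycle_cyclic ?prime_cyclic ?oP //.
by rewrite orderE in oz; rewrite oz coprime_sym coprime2p.
Qed.

Lemma join_involution z y : cent_involution z -> y \in P <*> <[z]> -> #[y] = 2 ->
  y = z.
Proof.
move=> iz yN oy; have [_ /eqP oz] := andP iz.
have : <[y]> == <[z]>.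
  rewrite (eq_subG_cyclic (join_cyclic iz)) ?cycle_subG //.
    by rewrite orderE in oz; rewrite orderE in oy; rewrite oy oz.
  by apply: (subsetP (joing_subr _ _)); apply: cycle_id.
move/eqP=> E; have : y \in <[z]> by rewrite -E cycle_id.
by rewrite (cycle2g oz) !inE -order_eq1 oy => /eqP.
Qed.

(** A stabilizer in this group of order 2p has neither elements of order 2, since
    [z] commutes with the transitive group [G], nor elements of order p, since
    those generate [P] and stabilizers in [G] have order prime to p. *)
Lemma join_cyclic_regular z : cent_involution z -> cyclic_regular (P <*> <[z]>).
Proof.
move=> iz; have cycN := join_cyclic iz; have oN := join_card iz.
have [zG /eqP oz] := andP iz.
have stab1 x : 'C_(P <*> <[z]>)[x | 'P] = 1.
  apply/eqP; rewrite trivg_card1 -dvdn1.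
  set S := 'C_(P <*> <[z]>)[x | 'P].
  have coS : coprime #|S| (2 * p).
    rewrite coprime_sym coprimeMl !prime_coprime //; apply/andP; split; apply/negP.
      case/Cauchy=> // y; rewrite mem_stab => /andP[yN /eqP yx] oy.
      have yz := join_involution iz yN oy; rewrite yz in yx.
      by move: oz; rewrite (cent_fix_eq1 zG yx) order1.
    case/Cauchy=> // y; rewrite mem_stab => /andP[yN /eqP yx] oy.
    have defP : <[y]> == P.
      rewrite (eq_subG_cyclic cycN) ?cycle_subG ?joing_subl //.
      by rewrite orderE in oy; rewrite oy oP.
    have yP : y \in P by rewrite -(eqP defP) cycle_id.
    have := stab_p' x; rewrite -oy order_dvdG // mem_stab yx eqxx andbT.
    exact: (subsetP (normal_sub nsPG)).
  by rewrite -(eqP coS) dvdn_gcd dvdnn -oN cardSg ?subsetIl.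
apply/and4P; split=> //.
- have [x _] := point_exists; apply/imsetP; exists x; rewrite ?in_setT //.
  apply/esym/eqP; rewrite eqEcard subsetT /= cardT -oN.
  by rewrite -(card_orbit_stab 'P [group of P <*> <[z]>] x) stab1 cards1 muln1.
- by apply/forallP => x; rewrite stab1.
- apply: normsY; [exact: normal_norm | apply: cents_norm].
  by rewrite centsC cycle_subG.
Qed.

Lemma cyclic_regular_join N : cyclic_regular N ->
  exists2 z, cent_involution z & N = (P <*> <[z]>)%G.
Proof.
move=> /cyclic_regular_struct[c [z [[cG oc] iz defN]]]; exists z => //.
by apply: val_inj; rewrite /= defN (cyclic_of_order_p cG oc).
Qed.

Lemma card_cyclic_regular :
  #|[set N | cyclic_regular N]| = #|[set z | cent_involution z]|.
Proof.
have -> : [set N | cyclic_regular N] =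
    [set (P <*> <[z]>)%G | z in [set z | cent_involution z]].
  apply/setP => N; rewrite inE; apply/idP/imsetP => [/cyclic_regular_join[z iz ->]|].
    by exists z; rewrite ?inE.
  by case=> z; rewrite inE => iz ->; apply: join_cyclic_regular.
rewrite card_in_imset // => y z; rewrite !inE => iy iz /(congr1 val)/= E.
apply: (join_involution iz); last by case/andP: iy => _ /eqP.
by rewrite -E; apply: (subsetP (joing_subr _ _)); apply: cycle_id.
Qed.

End NormalSylow.

Lemma sylow_of_card (Q : {group {perm T}}) k : Q \subset G -> #|Q| = p ->
  #|G| = (p * k)%N -> ~~ (p %| k) -> p.-Sylow(G) Q.
Proof.
move=> sQG oQ oG pk; rewrite /pHall sQG /pgroup oQ pnat_id //=.
by rewrite p'natE // -divgS // oQ oG mulKn ?prime_gt0.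
Qed.

Lemma p_ndvd_div_pred k : k %| p.-1 -> 0 < k /\ ~~ (p %| k).
Proof.
have p1 : 0 < p.-1 by rewrite -subn1 subn_gt0 prime_gt1.
move=> kp; split; first exact: dvdn_gt0 kp.
apply/negP => pk; have := dvdn_leq p1 (dvdn_trans pk kp).
by rewrite leqNgt prednK ?prime_gt0 // leqnn.
Qed.

(** The involution of the normal C_2p is central, so C_2p is itself a cyclic
    regular subgroup, hence self-centralizing; all involutions commuting with [G]
    are then in it. *)
Lemma card_cyclic_regular_C2p m : m %| p.-1 ->
  is_faithful_cyclic_sdprod G (2 * p) m ->
  #|[set N | cyclic_regular N]| = 1%N.
Proof.
move=> /p_ndvd_div_pred[m0 pm] [A [B [defG isoA isoB cBA]]].
have p0 := prime_gt0 p_pr.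
move: isoA isoB; rewrite !isog_ZpP ?muln_gt0 // => /andP[cycA /eqP oA] /andP[cycB /eqP oB].
have [/andP[sAG nAG] _ _ _ _] := sdprod_context defG.
have [c [z [cA zA oc oz defA]]] := card2p_parts cycA oA.
have nG (y : {perm T}) : y \in A -> G \subset 'N(<[y]>).
  by move=> yA; apply: char_norm_trans nAG; rewrite sub_cyclic_char ?cycle_subG.
have sPG : <[c]> \subset G by rewrite cycle_subG (subsetP sAG).
have nsPG : <[c]> <| G by rewrite /normal sPG nG.
have sylP : p.-Sylow(G) <[c]>.
  apply: (sylow_of_card (k := 2 * m)) => //.
    by rewrite -(sdprod_card defG) oA oB mulnCA mulnA.
  rewrite Euclid_dvdM // negb_or pm andbT dvdn_prime2 //.
  by apply: contraL p_odd => /eqP ->.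
have iz : cent_involution z.
  by rewrite /cent_involution (norm_involution_cent (nG z zA) oz) oz /=.
have defN : A = (<[c]> <*> <[z]>)%G.
  apply: val_inj; rewrite /= cent_joinEl ?defA //.
  by rewrite (subset_trans _ (centS (_ : _ \subset A))) ?cycle_subG ?(subsetP (cyclic_abelian cycA)).
rewrite (card_cyclic_regular oc nsPG sylP).
suffices -> : [set z | cent_involution z] = [set z] by rewrite cards1.
apply/setP => y; rewrite !inE; apply/idP/eqP => [iy | -> //].
have crA : cyclic_regular A by rewrite defN; apply: join_cyclic_regular sylP _ iz.
have [trA _ _ _] := and4P crA.
apply: (join_involution (P := <[c]>%G) oc nsPG iz); last by case/andP: iy => _ /eqP.
have : y \in A.
  apply: (subsetP (trans_cent_abelian trA (cyclic_abelian cycA))).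
  by case/andP: iy => /(subsetP (centS sAG)).
by rewrite defN.
Qed.

(** Together with the next lemma: involutions of the centralizer of [G] are the
    elements of order 2 of the normalizer quotient of a stabilizer. *)
Lemma stab_cent_involution x y : y \in G -> y \in 'N('C_G[x | 'P]) ->
  y \notin 'C_G[x | 'P] -> y * y \in 'C_G[x | 'P] ->
  exists2 z, cent_involution z & z x = y x.
Proof.
move=> yG yS; rewrite !mem_stab yG groupM //= => yx /eqP yyx.
have [z zG zx] := stab_norm_cent trG yG yS; exists z => //.
rewrite /cent_involution zG; apply/eqP/nt_prime_order => //.
  apply: (cent_fix_eq1 (x := x)); first by rewrite groupX.
  by rewrite expgS expg1 permM zx (cent_apply _ zG yG) zx -permM.
by apply: contraNneq yx => z1; rewrite -zx z1 perm1.
Qed.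

Lemma cent_involution_stab x z : cent_involution z ->
  exists y, [/\ y \in G, z x = y x, y \in 'N('C_G[x | 'P]),
                y \notin 'C_G[x | 'P] & y * y \in 'C_G[x | 'P]].
Proof.
case/andP=> zG /eqP oz; have zz t : z (z t) = t.
  by have := expg_order z; rewrite oz expgS expg1 -permM => ->; rewrite perm1.
have [y yG E] := atransP2 trG (in_setT x) (in_setT (z x)); rewrite /= /aperm in E.
have yzx : y (z x) = x by rewrite -(cent_apply _ zG yG) -E zz.
have yVx : y^-1 x = z x by rewrite -[in LHS]yzx permK.
exists y; split=> //.
- rewrite inE; apply/subsetP => _ /imsetP[s sS ->].
  move: sS; rewrite !mem_stab => /andP[sG /eqP sx]; rewrite groupJ //=.
  by rewrite conjgE !permM yVx -(cent_apply _ zG sG) sx yzx.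
- rewrite mem_stab yG /= -E; apply/negP => /eqP zx.
  by move: oz; rewrite (cent_fix_eq1 zG zx) order1.
by rewrite mem_stab groupM //= permM -E yzx.
Qed.

Section CpSdprod.

Variables (m : nat) (P Q : {group {perm T}}).
Hypotheses (mp : m %| p.-1) (defG : P ><| Q = G).
Hypotheses (oP : #|P| = p) (oQ : #|Q| = m) (cycQ : cyclic Q) (cQP : 'C_Q(P) = 1).

Lemma Cp_sdprod_normal : P <| G.
Proof. by have [-> _ _ _ _] := sdprod_context defG. Qed.

Lemma Cp_sdprod_card : #|G| = (p * m)%N.
Proof. by rewrite -(sdprod_card defG) oP oQ. Qed.

Lemma Cp_sdprod_sylow : p.-Sylow(G) P.
Proof.
have [m0 pm] := p_ndvd_div_pred mp.
exact: sylow_of_card (normal_sub Cp_sdprod_normal) oP Cp_sdprod_card pm.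
Qed.

(** In particular such a transitive group of degree 2p exists only for even [m]. *)
Lemma Cp_sdprod_stab x : m = (2 * #|'C_G[x | 'P]|)%N.
Proof.
have := trans_card_stab x trG; rewrite Cp_sdprod_card mulnAC mulnC => /eqP.
by rewrite eqn_pmul2r ?prime_gt0 // => /eqP.
Qed.

(** The stabilizer [S], of order m/2 prime to p, lies in a conjugate [Q1] of [Q],
    which normalizes it.  As [S] is nontrivial it does not centralize [P], so no
    element of order p normalizes [S]: [Q1] is the whole normalizer, and its only
    coset of [S] besides [S] gives the only involution. *)
Lemma card_cyclic_regular_Cp : m <> 2 -> #|[set N | cyclic_regular N]| = 1%N.
Proof.
move=> m2; have [m0 pm] := p_ndvd_div_pred mp.
rewrite (card_cyclic_regular oP Cp_sdprod_normal Cp_sdprod_sylow).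
have [x _] := point_exists; pose S := 'C_G[x | 'P]%G.
have sSG : S \subset G by apply: subsetIl.
have oS : m = (2 * #|S|)%N := Cp_sdprod_stab x.
have abQ := cyclic_abelian cycQ.
have [_ sQG _ _ _] := sdprod_context defG.
have solG : solvable G.
  rewrite (series_sol Cp_sdprod_normal) !abelian_sol //.
    by rewrite -(isog_abelian (sdprod_isog defG)).
  by rewrite cyclic_abelian // prime_cyclic ?oP.
have hallQ : p^'.-Hall(G) Q.
  rewrite /pHall sQG /pgroup oQ p'natE // pm /= -divgS // Cp_sdprod_card oQ mulnK //.
  by rewrite pnatNK pnat_id.
have [||g gG sSQ] := Hall_subJ (K := S) solG hallQ; first by [].
  by rewrite /pgroup p'natE // (stab_p' oP Cp_sdprod_normal Cp_sdprod_sylow).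
(* S is a group of order prime to p, so Hall's theorem puts it in Q :^ g. *)
pose Q1 := (Q :^ g)%G.
have abQ1 : abelian Q1 by rewrite abelianJ.
have oQ1 : #|Q1| = (2 * #|S|)%N by rewrite cardJg oQ.
have sQ1G : Q1 \subset G by rewrite conj_subG.
have nPg : P :^ g = P by apply: normsP gG; apply: normal_norm Cp_sdprod_normal.
have cQ1P : 'C_Q1(P) = 1 by rewrite -{1}nPg centJ -conjIg cQP conjs1g.
have nSQ1 : Q1 \subset 'N(S).
  by apply: cents_norm; apply: (subset_trans abQ1); apply: centS.
(* An element of order p normalizing S would make P and S commute. *)
have defN : 'N_G(S) = Q1.
  apply/eqP; rewrite eq_sym eqEcard subsetI sQ1G nSQ1 /=.
  apply: dvdn_leq; rewrite ?cardG_gt0 //.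
  have : #|'N_G(S)| %| p * #|Q1| by rewrite cardJg oQ -Cp_sdprod_card cardSg ?subsetIl.
  rewrite Gauss_dvdr // coprime_sym prime_coprime //; apply/negP.
  case/Cauchy=> // y /setIP[yG yS] oy.
  have defP := cyclic_of_order_p oP Cp_sdprod_normal Cp_sdprod_sylow yG oy.
  have nSP : P \subset 'N(S) by rewrite -defP cycle_subG.
  have tiPS : P :&: S = 1.
    rewrite coprime_TIg // oP prime_coprime //.
    exact: stab_p' oP Cp_sdprod_normal Cp_sdprod_sylow x.
  have cSP : S \subset 'C(P).
    rewrite centsC; apply/commG1P/trivgP; rewrite /= -tiPS subsetI.
    rewrite commg_subl commg_subr nSP andbT.
    exact: subset_trans sSG (normal_norm Cp_sdprod_normal).
  have : S \subset 'C_Q1(P) by rewrite subsetI sSQ.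
  rewrite cQ1P => /trivgP S1; apply: m2.
  by rewrite oS S1 cards1.
have [y yQ yS] : exists2 y, y \in Q1 & y \notin S.
  apply/subsetPn; apply: contraTN isT => /subset_leq_card.
  by rewrite oQ1 leqNgt ltn_Pmull ?cardG_gt0.
have yyS : y * y \in S.
  rewrite -[X in _ * X]invgK; apply: (@index2_div _ S Q1) => //.
    by rewrite inE yS.
  by rewrite in_setD !groupV yS.
have [z iz zx] := stab_cent_involution (subsetP sQ1G y yQ) (subsetP nSQ1 y yQ) yS yyS.
suffices -> : [set z | cent_involution z] = [set z] by rewrite cards1.
apply/setP => z'; rewrite !inE; apply/idP/eqP => [iz' | -> //].
have [y' [yG' zx' yN' yS' _]] := cent_involution_stab x iz'.
have yQ' : y' \in Q1 by rewrite -defN inE yG'.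
case/andP: iz => zG _; case/andP: iz' => zG' _.
apply: (cent_trans_eq trG zG' zG (x := x)); rewrite zx zx'.
have : y' * y^-1 \in S by rewrite (@index2_div _ S Q1) // inE ?yS ?yS'.
by rewrite mem_stab permM => /andP[_ /eqP/(canRL (permKV _))].
Qed.

Lemma Cp_sdprod_cent : 'C_G(P) = P.
Proof.
have [_ _ defPQ _ _] := sdprod_context defG.
have abP : P \subset 'C(P) by rewrite -/(abelian P) cyclic_abelian // prime_cyclic ?oP.
apply/eqP; rewrite eqEsubset subsetI abP (normal_sub Cp_sdprod_normal) !andbT.
apply/subsetP => y /setIP[]; rewrite -defPQ => /mulsgP[a b aP bQ ->] cab.
have : b \in 'C_Q(P).
  by rewrite inE bQ /=; rewrite groupMl // (subsetP abP) in cab.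
by rewrite cQP => /set1P->; rewrite mulg1.
Qed.

(** Otherwise its square, which lies in [P], would generate [P], and [y] would
    centralize [P]. *)
Lemma Dp_outer_involution (y : {perm T}) : m = 2 -> y \in G :\: P -> #[y] = 2.
Proof.
move=> m2 /setDP[yG yP].
have yyP : y * y \in P.
  rewrite -[X in _ * X]invgK; apply: (@index2_div _ P G) => //.
  - exact: normal_sub Cp_sdprod_normal.
  - by rewrite Cp_sdprod_card m2 oP mulnC.
  - by rewrite inE yP.
  - by rewrite in_setD !groupV yP.
have y2 : y ^+ 2 \in P by rewrite expgS expg1.
have [y21 | y2n1] := eqVneq (y ^+ 2) 1.
  by apply: nt_prime_order => //; apply: contraNneq yP => ->.
case/negP: yP; rewrite -Cp_sdprod_cent inE yG /=.
have oy2 : #[y ^+ 2] = p.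
  by apply: nt_prime_order y2n1 => //; apply/eqP; rewrite -order_dvdn -oP order_dvdG.
rewrite -(cyclic_of_order_p oP Cp_sdprod_normal Cp_sdprod_sylow (groupX 2 yG) oy2).
by rewrite cent_cycle; apply/cent1P/commuteX/commute_refl.
Qed.

Lemma Dp_involutions : m = 2 -> [set y in G | #[y] == 2] = G :\: P.
Proof.
move=> m2; apply/setP => y; apply/idP/idP => [|yGP].
  rewrite !inE => /andP[-> /eqP oy]; rewrite andbT.
  by apply: contraL p_odd => /order_dvdG; rewrite oy oP dvdn2.
by have [yG _] := setDP yGP; rewrite inE yG (Dp_outer_involution m2 yGP).
Qed.

Lemma card_Dp_involutions : m = 2 -> #|[set y in G | #[y] == 2]| = p.
Proof.
move=> m2; rewrite Dp_involutions // cardsD (setIidPr (normal_sub Cp_sdprod_normal)).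
by rewrite Cp_sdprod_card oP m2 muln2 -addnn addnK.
Qed.

(** Stabilizers are trivial, so both the involutions commuting with [G] and the
    involutions of [G] are determined by the image of a point, and the same
    images occur. *)
Lemma card_cyclic_regular_Dp : m = 2 -> #|[set N | cyclic_regular N]| = p.
Proof.
move=> m2; rewrite (card_cyclic_regular oP Cp_sdprod_normal Cp_sdprod_sylow).
have [x _] := point_exists.
have S1 : 'C_G[x | 'P] = 1.
  apply/eqP; rewrite trivg_card1; have := Cp_sdprod_stab x; rewrite m2.
  by move/eqP; rewrite -{1}[2]muln1 eqn_pmul2l // eq_sym.
have inj1 : {in [set z | cent_involution z] &, injective (fun z : {perm T} => z x)}.
  move=> y z; rewrite !inE => /andP[yG _] /andP[zG _].
  exact: cent_trans_eq trG yG zG.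
have inj2 : {in [set y in G | #[y] == 2] &, injective (fun z : {perm T} => z x)}.
  move=> y z; rewrite !inE => /andP[yG _] /andP[zG _] yz.
  have : y * z^-1 \in 'C_G[x | 'P].
    by rewrite mem_stab groupM ?groupV //= permM yz permK.
  by rewrite S1 => /set1P/eqP; rewrite -eq_mulgV1 => /eqP.
rewrite -(card_in_imset inj1) -card_Dp_involutions // -(card_in_imset inj2).
apply: eq_card => t; apply/imsetP/imsetP => [] [z]; rewrite inE => iz ->.
  have [y [yG yx _ yS yyS]] := cent_involution_stab x iz; exists y => //.
  rewrite inE yG; apply/eqP/nt_prime_order => //.
    by move: yyS; rewrite S1 expgS expg1 => /set1P.
  by apply: contraNneq yS => ->; rewrite S1 group1.
case/andP: iz => zG /eqP oz.
have z1 : z != 1 by rewrite -order_eq1 oz.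
have [||| y iy yx] := stab_cent_involution (x := x) zG.
- by rewrite S1 norm1 in_setT.
- by rewrite S1 inE.
- by rewrite S1 inE -(expg_order z) oz expgS expg1.
by exists y; rewrite ?inE.
Qed.

(** Two distinct involutions generate a dihedral subgroup, whose order is an even
    divisor of 2p other than 2. *)
Lemma Cp_sdprod_C2_dihedral : m = 2 -> G \isog 'D_(2 * p).
Proof.
move=> m2; have := card_Dp_involutions m2.
set I := [set y in G | _] => oI.
have /card_gt1P[y [z [yI zI nyz]]] : 1 < #|I| by rewrite oI prime_gt1.
move: yI zI; rewrite !inE => /andP[yG /eqP oy] /andP[zG /eqP oz].
have := involutions_gen_dihedral oy oz nyz.
set D := <<_>>; have sDG : D \subset G by rewrite gen_subG subUset !sub1set yG zG.
have oG : #|G| = (2 * p)%N by rewrite Cp_sdprod_card m2 mulnC.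
suffices -> : D = G by rewrite oG.
apply/eqP; rewrite eqEcard sDG oG /=.
have yD : y \in D by rewrite mem_gen ?set21.
have zD : z \in D by rewrite mem_gen ?set22.
have /dvdnP[k oD] : 2 %| #|D| by rewrite -oy order_dvdG.
have : #|D| %| 2 * p by rewrite -oG cardSg.
rewrite oD mulnC dvdn_pmul2l // => kp.
rewrite leq_pmul2l //; have [k1 | -> //] := pred2P ((primeP p_pr).2 k kp).
have defD : <[y]> == D by rewrite eqEcard cycle_subG yD oD k1 -orderE oy.
move: zD; rewrite -(eqP defD) (cycle2g oy) !inE => /orP[] /eqP zE.
  by move: oz; rewrite zE order1.
by rewrite zE eqxx in nyz.
Qed.

End CpSdprod.

(** Write N = P x <z>.  If [z] is in [G] then [N] is normal in [G] with a point
    stabilizer as complement.  If not, then [P] is its own centralizer in [G],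
    hence of index prime to p, and has a complement by Schur-Zassenhaus; its order
    is even because 2p divides that of [G]. *)
Lemma cyclic_regular_cases N : cyclic_regular N ->
  (exists2 m, m %| p.-1 & is_faithful_cyclic_sdprod G (2 * p) m) \/
  (exists2 m, ~~ odd m && (m %| p.-1) & is_faithful_cyclic_sdprod G p m).
Proof.
move=> crN; have oN := cyclic_regular_card crN; have p0 := prime_gt0 p_pr.
have [trN /forallP freeN nNG cycN] := and4P crN.
have [c [z [[cG oc] iz defN]]] := cyclic_regular_struct crN.
have abN := cyclic_abelian cycN; have cNN := trans_cent_abelian trN abN.
pose P := <[c]>%G; have oP : #|P| = p by [].
have sPG : P \subset G by rewrite cycle_subG.
have sPN : P \subset N by rewrite defN joing_subl.
have nPG : G \subset 'N(P) by apply: char_norm_trans nNG; rewrite sub_cyclic_char.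
have zN : z \in N by rewrite defN (subsetP (joing_subr _ _)) ?cycle_id.
have [zG oz] := andP iz.
have cGP : 'C_G(P) \subset N.
  apply/subsetP => y /setIP[yG yP]; apply: (subsetP cNN).
  by rewrite defN centY inE yP cent_cycle; apply/cent1P/commute_sym; apply: (centP zG).
have [x _] := point_exists.
have Nx : 'C_N[x | 'P] = 1 by apply/eqP.
have [zinG | znG] := boolP (z \in G); [left | right].
  have sNG : N \subset G by rewrite defN join_subG sPG cycle_subG.
  pose B := 'C_G[x | 'P]%G.
  have tiNB : N :&: B = 1 by rewrite /= setIA (setIidPl sNG).
  have sBG : B \subset G by apply: subsetIl.
  have cBP : 'C_B(P) = 1.
    apply/trivgP; rewrite -tiNB subsetI subsetIl andbT.
    by apply: subset_trans cGP; apply: setSI.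
  have [cycB oB] := faithful_prime_cyclic p_pr oP (subset_trans sBG nPG) cBP.
  exists #|B| => //; exists N, B; split.
  - rewrite sdprodE ?(subset_trans sBG nNG) //.
    rewrite -(normC (subset_trans sBG nNG)).
    exact/(subgroup_transitiveP (in_setT x) sNG trG).
  - by rewrite isog_ZpP ?muln_gt0 // cycN oN eqxx.
  - by rewrite isog_ZpP ?cardG_gt0 // cycB eqxx.
  - by apply/trivgP; rewrite -cBP setIS // centS.
have cGP' : 'C_G(P) = P.
  have abP : P \subset 'C(P) := cycle_abelian c.
  apply/eqP; rewrite eqEsubset subsetI sPG abP !andbT.
  apply/subsetP => y yC; have yG := subsetP (subsetIl _ _) y yC.
  have := subsetP cGP y yC; rewrite defN cent_joinEl; last first.
    by rewrite (subset_trans sPN) // (subset_trans abN) // centS ?cycle_subG.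
  case/mulsgP => a b aP bz yE; move: bz; rewrite /= (cycle2g (eqP oz)) !inE.
  case/orP => /eqP bE; first by rewrite yE bE mulg1; apply: aP.
  case/negP: znG; rewrite -bE -[b](mulKg a) -yE groupM ?groupV //.
  exact: (subsetP sPG).
have oGP : #|G : P| %| p.-1.
  have -> : p.-1 = #|Aut P|.
    by rewrite card_Aut_cyclic ?cycle_cyclic // oP totient_prime.
  have -> : #|G : P| = #|conj_aut P @* G|.
    by rewrite card_morphim ker_conj_aut (setIidPr nPG) -{1}cGP' indexgI.
  by apply: cardSg; apply: Aut_conj_aut.
have [_ pGP] := p_ndvd_div_pred oGP.
have hallP : Hall G P by rewrite /Hall sPG oP prime_coprime.
have nsPG : P <| G by rewrite /normal sPG.
have /splitsP[Q /complP[tiPQ defG]] := SchurZassenhaus_split hallP nsPG.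
have sQG : Q \subset G by rewrite -defG mulG_subr.
have cQP : 'C_Q(P) = 1.
  by apply/trivgP; rewrite -tiPQ subsetI subsetIl andbT -{2}cGP' setSI.
have [cycQ oQ] := faithful_prime_cyclic p_pr oP (subset_trans sQG nPG) cQP.
exists #|Q|.
  rewrite oQ andbT -dvdn2 -(dvdn_pmul2l p0) -{2}oP -TI_cardMg // defG mulnC.
  by rewrite -cardT (atrans_dvd trG).
exists P, Q; split=> //.
- by rewrite sdprodE // (subset_trans sQG nPG).
- by rewrite isog_ZpP // cycle_cyclic oP eqxx.
- by rewrite isog_ZpP ?cardG_gt0 // cycQ eqxx.
Qed.

End DegreeTwoP.

(** * Transport of semidirect decompositions *)

Lemma faithful_sdprod_isog (aT rT : finGroupType) (A : {group aT})
    (f : {morphism A >-> rT}) n m : 'injm f ->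
  is_faithful_cyclic_sdprod A n m -> is_faithful_cyclic_sdprod (f @* A)%G n m.
Proof.
move=> injf [B [C [defA isoB isoC cCB]]].
have [/andP[sBA _] sCA _ _ _] := sdprod_context defA.
exists (f @* B)%G, (f @* C)%G; split.
- exact: injm_sdprod.
- by apply: isog_trans isoB; rewrite isog_sym sub_isog.
- by apply: isog_trans isoC; rewrite isog_sym sub_isog.
- by rewrite /= -injm_subcent // cCB morphim1.
Qed.

Lemma faithful_sdprod_isog_inv (aT rT : finGroupType) (A : {group aT})
    (f : {morphism A >-> rT}) n m : 'injm f ->
  is_faithful_cyclic_sdprod (f @* A)%G n m -> is_faithful_cyclic_sdprod A n m.
Proof.
move=> injf /(faithful_sdprod_isog (f := invm_morphism injf) (injm_invm injf)).
case=> [B [C [defA isoB isoC cCB]]]; exists B, C; split=> //.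
by rewrite defA /= im_invm.
Qed.

Import GRing.Theory VectorInternalTheory.
Local Open Scope ring_scope.

(** * Bilinear calculus on coordinate tensors *)

HB.instance Definition _ (K : fieldType) (V W : vectType K) (U : lmodType K)
    (f : V -> W -> U) :=
  GRing.isLinear.Build K (tens V W) U _ (tens_lift f) (tens_lift_is_linear f).

(** For functions that are linear without carrying a canonical linear structure. *)
Lemma linfun_linearE (K : fieldType) (V W : vectType K) (f : V -> W) :
  linear f -> linfun f =1 f.
Proof.
move=> fl v; pose l := GRing.isLinear.Build K V W _ f fl.
pose F : {linear V -> W} := HB.pack f l.
exact: (lfunE F).
Qed.

Lemma linear_tens_lift (K : fieldType) (V W : vectType K) (U U' : lmodType K)
    (g : {linear U -> U'}) (f : V -> W -> U) t :
  g (tens_lift f t) = tens_lift (fun v w => g (f v w)) t.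
Proof.
rewrite /tens_lift linear_sum; apply: eq_bigr => i _.
by rewrite linear_sum; apply: eq_bigr => j _; rewrite linearZ.
Qed.

Lemma tens_lift_ext (K : fieldType) (V W : vectType K) (U : lmodType K)
    (f f' : V -> W -> U) t :
  (forall v w, f v w = f' v w) -> tens_lift f t = tens_lift f' t.
Proof.
by move=> ff'; apply: eq_bigr => i _; apply: eq_bigr => j _; rewrite ff'.
Qed.

Lemma tens_lift_sum (K : fieldType) (V W : vectType K) (U : lmodType K)
    (I : finType) (P : pred I) (f : I -> V -> W -> U) t :
  tens_lift (fun v w => \sum_(i | P i) f i v w) t = \sum_(i | P i) tens_lift (f i) t.
Proof.
rewrite /tens_lift [RHS]exchange_big; apply: eq_bigr => i _.
rewrite [RHS]exchange_big; apply: eq_bigr => j _.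
by rewrite scaler_sumr.
Qed.

Lemma tens_lift_mull (K : fieldType) (V W : vectType K) (U : algType K)
    (c : U) (f : V -> W -> U) t :
  tens_lift (fun v w => c * f v w) t = c * tens_lift f t.
Proof.
rewrite /tens_lift mulr_sumr; apply: eq_bigr => i _.
by rewrite mulr_sumr; apply: eq_bigr => j _; rewrite -scalerAr.
Qed.

Lemma tens_lift_mulr (K : fieldType) (V W : vectType K) (U : algType K)
    (c : U) (f : V -> W -> U) t :
  tens_lift (fun v w => f v w * c) t = tens_lift f t * c.
Proof.
rewrite /tens_lift mulr_suml; apply: eq_bigr => i _.
by rewrite mulr_suml; apply: eq_bigr => j _; rewrite -scalerAl.
Qed.

Lemma dim_tens (K : fieldType) (V W : vectType K) :
  dim (tens V W) = (dim V * dim W)%N.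
Proof. by []. Qed.

Lemma ffun_basis_expand (K : fieldType) (M : lmodType K) (X : finType)
    (V : vectType K) (phi : {linear V -> {ffun X -> M}}) v x :
  phi v x = \sum_i v2r v 0 i *: phi (r2v (delta_mx 0 i)) x.
Proof.
rewrite {1}[v]v2r_basis linear_sum sum_ffunE; apply: eq_bigr => i _.
by rewrite linearZ /= ffunE.
Qed.

Lemma tens_lift_swap (K : fieldType) (V W : vectType K) (U : lmodType K)
    (f : V -> W -> U) (t : tens V W) :
  tens_lift f t = tens_lift (fun w v => f v w) ((t : 'M_(_, _))^T : tens W V).
Proof.
rewrite /tens_lift exchange_big; apply: eq_bigr => j _.
by apply: eq_bigr => i _; rewrite mxE.
Qed.

Section TensEval.

Variables (K : fieldType) (M : comAlgType K) (X Y : finType) (V W : vectType K).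

(** The tensor of two function spaces, seen as functions on the product. *)
Definition tens_eval (phi : V -> {ffun X -> M}) (psi : W -> {ffun Y -> M})
    (t : tens V W) : {ffun X * Y -> M} :=
  [ffun z => tens_lift (fun v w => phi v z.1 * psi w z.2) t].

Lemma tens_evalE phi psi t x y :
  tens_eval phi psi t (x, y) = tens_lift (fun v w => phi v x * psi w y) t.
Proof. by rewrite ffunE. Qed.

Lemma tens_eval_is_linear phi psi : linear (tens_eval phi psi).
Proof. by move=> a s t; apply/ffunP => z; rewrite !ffunE linearP. Qed.

HB.instance Definition _ phi psi :=
  GRing.isLinear.Build K (tens V W) _ _ (tens_eval phi psi)
    (tens_eval_is_linear phi psi).

Variables (phi : {linear V -> {ffun X -> M}}) (psi : {linear W -> {ffun Y -> M}}).

Lemma tens_eval_pure v w x y :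
  tens_eval phi psi (pure v w) (x, y) = phi v x * psi w y.
Proof.
rewrite tens_evalE tens_lift_pure // => [u a v1 v2 | u a w1 w2].
  by rewrite linearP !ffunE mulrDl scalerAl.
by rewrite linearP !ffunE mulrDr scalerAr.
Qed.

Lemma tens_eval_lift (V' W' : vectType K) (f : V' -> W' -> tens V W) t z :
  tens_eval phi psi (tens_lift f t) z =
  tens_lift (fun v w => tens_eval phi psi (f v w) z) t.
Proof.
rewrite linear_tens_lift /tens_lift sum_ffunE; apply: eq_bigr => i _.
by rewrite sum_ffunE; apply: eq_bigr => j _; rewrite ffunE.
Qed.

Lemma tens_eval_map (V' W' : vectType K) (f : V' -> V) (g : W' -> W) t x y :
  tens_eval phi psi (tens_map f g t) (x, y) =
  tens_lift (fun v w => phi (f v) x * psi (g w) y) t.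
Proof.
rewrite tens_eval_lift; apply: tens_lift_ext => v w; exact: tens_eval_pure.
Qed.

End TensEval.

(** * Galois descent for functions on a finite set with a Galois action *)

Section Equivariant.

Variables (K : fieldType) (M : splittingFieldType K).
Hypothesis galM1 : galois 1 {:M}.

Lemma galois_trace_base (c : M) :
  exists k : K, \sum_(g : gal_of {:M}) g c = k%:A.
Proof.
have := mem_galTrace galM1 (memvf c); rewrite /galTrace => /vlineP[k Ek].
by exists k; rewrite -Ek; apply: eq_bigl => g; rewrite gal_full.
Qed.

Lemma galois_fixed_base (c : M) : (forall g : gal_of {:M}, g c = c) ->
  exists k : K, c = k%:A.
Proof.
move=> cG; apply/vlineP; rewrite -(galois_fixedField galM1).
by apply/fixedFieldP; rewrite ?memvf.
Qed.

(** Dedekind's theorem for the full automorphism group of [M]. *)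
Lemma galois_independent (c : gal_of {:M} -> M) :
  (forall m, \sum_g c g * g m = 0) -> forall g, c g = 0.
Proof.
move=> c0 g; apply: (@gal_independent _ _ {:M} xpredT c) => // m _; exact: c0.
Qed.

Lemma galois_trace1 : exists m : M, \sum_(g : gal_of {:M}) g m = 1.
Proof.
have [|m _] := @gal_independent_contra _ _ {:M} xpredT (fun=> 1) 1%g isT.
  exact: oner_neq0.
rewrite (eq_bigr (fun g : gal_of {:M} => g m)) => [|g _]; last by rewrite mul1r.
have [k Ek] := galois_trace_base m; rewrite Ek => nzk.
exists (k^-1 *: m); transitivity (k^-1 *: k%:A : M).
  by rewrite -Ek scaler_sumr; apply: eq_bigr => g _; rewrite linearZ.
rewrite scalerA mulVf ?scale1r //; apply: contraNneq nzk => ->.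
by rewrite scale0r.
Qed.

Section Independence.

Variables (X : finType) (act : gal_of {:M} -> X -> X) (V : vectType K).
Variable phi : {linear V -> {ffun X -> M}}.
Hypothesis act_surj : forall g x, exists y, act g y = x.
Hypothesis phi_inj : injective phi.
Hypothesis phi_equi : forall g v x, phi v (act g x) = g (phi v x).

(** If sum_i c_i phi(e_i) = 0 with [c_i] in [M], equivariance gives the same relation
    with coefficients g(c_i), hence with coefficients Tr(m c_i), which are in [K] and
    so vanish for all [m]; thus [c_i = 0] by Dedekind. *)
Lemma equivariant_free (c : 'I_(dim V) -> M) :
  (forall x, \sum_i c i * phi (r2v (delta_mx 0 i)) x = 0) -> forall i, c i = 0.
Proof.
move=> c0.
have cg (g : gal_of {:M}) x : \sum_i g (c i) * phi (r2v (delta_mx 0 i)) x = 0.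
  have [y <-] := act_surj g x.
  have /(congr1 g) := c0 y; rewrite rmorph0 rmorph_sum; apply: etrans.
  by apply: eq_bigr => i _; rewrite phi_equi rmorphM.
(* The traces are the coordinates, in K, of a vector sent to 0 by phi. *)
have tr0 m i : \sum_(g : gal_of {:M}) g (m * c i) = 0.
  have /fin_all_exists[k Ek] := fun i => galois_trace_base (m * c i).
  suffices k0 : \row_i k i = 0 by rewrite Ek; move/rowP/(_ i): k0; rewrite !mxE => ->; rewrite scale0r.
  apply: (can_inj r2vK); rewrite linear0; apply: phi_inj; rewrite linear0.
  apply/ffunP => x; rewrite ffunE ffun_basis_expand.
  transitivity (\sum_(g : gal_of {:M}) g m * \sum_i g (c i) * phi (r2v (delta_mx 0 i)) x).
    transitivity (\sum_i \sum_(g : gal_of {:M}) g m * (g (c i) * phi (r2v (delta_mx 0 i)) x)); last first.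
      by rewrite exchange_big; apply: eq_bigr => g _; rewrite mulr_sumr.
    apply: eq_bigr => j _ /=.
    rewrite r2vK mxE -mulr_algl -Ek mulr_suml.
    by apply: eq_bigr => g _; rewrite rmorphM mulrA.
  by apply: big1 => g _; rewrite cg mulr0.
move=> i; have := galois_independent (c := fun g => g (c i)).
move=> /(_ _ 1%g); rewrite gal_id; apply => m.
by apply: etrans (tr0 m i); apply: eq_bigr => g _; rewrite rmorphM mulrC.
Qed.

Variables (Y : finType) (W : vectType K) (psi : {linear W -> {ffun Y -> M}}).
Hypothesis psi_inj : injective psi.

(** The equivariant factor stays free over [M], so its coefficients, which are
    values of [psi], vanish. *)
Lemma tens_eval_inj : injective (tens_eval phi psi).
Proof.
apply: raddf_inj => t /ffunP Jt0.
have t0 x y : tens_lift (fun v w => phi v x * psi w y) t = 0.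
  by have := Jt0 (x, y); rewrite tens_evalE ffunE.
apply/matrixP => i0 j0; rewrite [RHS]mxE.
have ty y i : \sum_j (t : 'M_(_, _)) i j *: psi (r2v (delta_mx 0 j)) y = 0.
  move: i; apply: equivariant_free => x; apply: etrans (t0 x y); rewrite /tens_lift.
  apply: eq_bigr => i _; rewrite mulr_suml; apply: eq_bigr => j _.
  by rewrite -scalerAl [in RHS]mulrC.
suffices /rowP/(_ j0) : row i0 (t : 'M_(_, _)) = 0 by rewrite !mxE.
apply: (can_inj r2vK); rewrite linear0; apply: psi_inj; rewrite linear0.
apply/ffunP => y; rewrite ffunE ffun_basis_expand; apply: etrans (ty y i0); apply: eq_bigr => j _.
by rewrite r2vK mxE.
Qed.

End Independence.
End Equivariant.

Section Descent.

Variables (K : fieldType) (M : splittingFieldType K).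
Variables (X : finType) (act : gal_of {:M} -> X -> X) (S : {set X}).

Definition equi_defect (u : {ffun X -> M}) : {ffun gal_of {:M} * X -> M} :=
  [ffun z => u (act z.1 z.2) - z.1 (u z.2)].

Definition supp_defect (u : {ffun X -> M}) : {ffun X -> M} :=
  [ffun x => if x \in S then 0 else u x].

Lemma equi_defect_linear : linear equi_defect.
Proof.
move=> a u v; apply/ffunP => z; rewrite !ffunE linearP scalerBr.
by rewrite opprD addrACA.
Qed.

Lemma supp_defect_linear : linear supp_defect.
Proof.
move=> a u v; apply/ffunP => z; rewrite !ffunE.
by case: ifP; rewrite ?scaler0 ?addr0.
Qed.

HB.instance Definition _ :=
  GRing.isLinear.Build K _ _ _ equi_defect equi_defect_linear.
HB.instance Definition _ :=
  GRing.isLinear.Build K _ _ _ supp_defect supp_defect_linear.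

(** The functions with support in [S] commuting with the Galois action, as a
    subspace over [K]. *)
Definition descent_space : {vspace {ffun X -> M}} :=
  (lker (linfun equi_defect) :&: lker (linfun supp_defect))%VS.

Lemma descent_spaceP (u : {ffun X -> M}) :
  reflect ((forall g x, u (act g x) = g (u x)) /\
           (forall x, x \notin S -> u x = 0))
          (u \in descent_space).
Proof.
rewrite memv_cap !memv_ker !lfunE /=; apply: (iffP andP).
  case=> /eqP/ffunP eu /eqP/ffunP su; split=> [g x | x xS].
    by have:= eu (g, x); rewrite !ffunE => /eqP; rewrite subr_eq0 => /eqP.
  by have := su x; rewrite !ffunE (negPf xS).
case=> eu su; split; apply/eqP/ffunP=> z; rewrite !ffunE.
  by rewrite eu subrr.
by case: ifPn => // /su.
Qed.

Hypothesis galM1 : galois 1 {:M}.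
Hypothesis actM : forall g h x, act (g * h)%g x = act h (act g x).
Hypothesis act1 : forall x, act 1%g x = x.
Hypothesis act_stable : forall g x, x \in S -> act g x \in S.

Lemma act_surjective g x : exists y, act g y = x.
Proof. by exists (act g^-1%g x); rewrite -actM mulVg act1. Qed.

(** The sum of the Galois conjugates of the function equal to [m] at [x0] and to 0
    elsewhere. *)
Lemma descent_average_mem m x0 : x0 \in S ->
  [ffun x => \sum_(g | act g x0 == x) g m] \in descent_space.
Proof.
move=> x0S; apply/descent_spaceP; split=> [h x | x].
  rewrite !ffunE rmorph_sum (reindex_inj (mulIg h)) /=.
  apply: eq_big => [g | g _]; last by rewrite galM ?memvf.
  rewrite actM; apply/eqP/eqP => [E | -> //].
  by rewrite -[LHS]act1 -[RHS]act1 -(mulgV h) !actM E.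
move=> xS; rewrite ffunE big1 // => g /eqP Ex.
by rewrite -Ex act_stable in xS.
Qed.

(** Applied to the averages at [x0], the hypothesis is a linear relation between
    automorphisms whose coefficient at 1 is [c x0]. *)
Lemma descent_separates (c : X -> M) :
  (forall u, u \in descent_space -> \sum_x c x * u x = 0) ->
  forall x, x \in S -> c x = 0.
Proof.
move=> c0 x0 x0S.
have := galois_independent (c := fun g => c (act g x0)).
rewrite -{3}[x0]act1; apply=> m.
apply: etrans (c0 _ (descent_average_mem m x0S)).
under [RHS]eq_bigr => x _ do rewrite ffunE mulr_sumr.
rewrite (exchange_big_dep xpredT) //=; apply: eq_bigr => g _.
by rewrite (big_pred1 (act g x0)) => // x; rewrite eq_sym.
Qed.

Local Notation D := (subvs_of descent_space).
Local Notation d := (dim D).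

(** The functions of [descent_space] span over [M] all functions supported in [S]:
    a linear form killing the former kills the latter. *)
Lemma descent_spans x0 : x0 \in S ->
  exists m : 'I_d -> M,
    forall x, \sum_i m i * vsval (r2v (delta_mx 0 i) : D) x = (x == x0)%:R.
Proof.
move=> x0S.
pose E : 'M[M]_(d, #|X|) :=
  \matrix_(i, k) vsval (r2v (delta_mx 0 i) : D) (enum_val k).
have /submxP[m Em] : ((delta_mx 0 (enum_rank x0) : 'rV[M]_#|X|) <= E)%MS.
  rewrite submxE; apply/eqP/matrixP => i j; rewrite [RHS]mxE -rowE mxE.
  pose c x := cokermx E (enum_rank x) j.
  suffices c0 : forall x, x \in S -> c x = 0 by apply: c0.
  apply: descent_separates => u Du.
  have -> : u = vsval (Subvs Du) by [].
  under eq_bigr => x _ do rewrite ffun_basis_expand mulr_sumr.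
  rewrite exchange_big big1 //= => k _.
  under eq_bigr => x _ do rewrite -scalerAr.
  rewrite -scaler_sumr.
  have /matrixP/(_ k j) := mulmx_coker E; rewrite mxE [RHS]mxE => E0.
  rewrite -[in RHS](scaler0 _ (v2r (Subvs Du) 0 k)); congr (_ *: _).
  rewrite -[RHS]E0 (reindex_onto enum_val enum_rank) => [|x _]; last first.
    by rewrite enum_rankK.
  by apply: eq_big => [l | l _]; rewrite ?enum_valK ?eqxx // mxE /c enum_valK mulrC.
exists (fun i => m 0 i) => x.
move/rowP/(_ (enum_rank x)): Em; rewrite !mxE (inj_eq enum_rank_inj) eqxx => ->.
by apply: eq_bigr => i _; rewrite mxE enum_rankK.
Qed.

Lemma dim_descent : d = #|S|.
Proof.
pose E : 'M[M]_(d, #|S|) :=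
  \matrix_(i, k) vsval (r2v (delta_mx 0 i) : D) (enum_val k).
apply/eqP; rewrite eqn_leq; apply/andP; split.
  suffices /eqP <- : row_free E by apply: rank_leq_col.
  apply/inj_row_free => c cE; apply/rowP => i; rewrite [RHS]mxE; move: i.
  apply: (@equivariant_free _ _ galM1 X act D vsval act_surjective) => [||x].
  - exact: val_inj.
  - by move=> g v x; case/descent_spaceP: (valP v).
  have [xS | xS] := boolP (x \in S); last first.
    rewrite big1 // => i _; case/descent_spaceP: (valP (r2v (delta_mx 0 i) : D)).
    by move=> _ /(_ _ xS) ->; rewrite mulr0.
  have /rowP/(_ (enum_rank_in xS x)) := cE; rewrite !mxE; apply: etrans.
  by apply: eq_bigr => i _; rewrite mxE enum_rankK_in.
suffices /eqP <- : row_full E by apply: rank_leq_row.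
rewrite -sub1mx; apply/row_subP => k; rewrite rowE mulmx1.
have [m Em] := descent_spans (enum_valP k).
apply/submxP; exists (\row_i m i); apply/rowP => l.
rewrite !mxE eqxx -(inj_eq enum_val_inj) -Em.
by apply: eq_bigr => i _; rewrite !mxE.
Qed.

End Descent.

Section DescentTensor.

Variables (K : fieldType) (M : splittingFieldType K).
Variables (X : finType) (act : gal_of {:M} -> X -> X) (S : {set X}).
Hypothesis galM1 : galois 1 {:M}.
Hypothesis actM : forall g h x, act (g * h)%g x = act h (act g x).
Hypothesis act1 : forall x, act 1%g x = x.
Hypothesis act_stable : forall g x, x \in S -> act g x \in S.

Local Notation D := (subvs_of (descent_space act S)).

(** For [m0] of trace 1, [u] is the sum of the conjugates of [m0 u].  Expanding
    [m0 u] over [M] in products of basis functions, the sum replaces its coefficients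
    by their traces, which are in [K]. *)
Lemma descent_tensor_surj (u : X -> X -> M) :
    (forall x y, (x \notin S) || (y \notin S) -> u x y = 0) ->
    (forall g x y, u (act g x) (act g y) = g (u x y)) ->
  exists t : tens D D,
    forall x y, tens_eval (@vsval _ _ _) (@vsval _ _ _) t (x, y) = u x y.
Proof.
move=> uS uG; have [m0 tr_m0] := galois_trace1 galM1.
have /fin_all_exists[m Em] (x : X) : exists mx : 'I_(dim D) -> M, x \in S ->
    forall y, \sum_i mx i * vsval (r2v (delta_mx 0 i) : D) y = (y == x)%:R.
  have [xS | _] := boolP (x \in S); last by exists (fun=> 0).
  by have [m Em] := descent_spans actM act1 act_stable xS; exists m.
pose c i j := \sum_x \sum_y m0 * u x y * (m x i * m y j).
have Ec x y : m0 * u x y = \sum_i \sum_j c i j *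
    (vsval (r2v (delta_mx 0 i) : D) x * vsval (r2v (delta_mx 0 j) : D) y).
  pose e i z := vsval (r2v (delta_mx 0 i) : D) z.
  transitivity (\sum_x' \sum_y' m0 * u x' y' *
      ((\sum_i m x' i * e i x) * (\sum_j m y' j * e j y))).
    have delta x' y' : m0 * u x' y' *
        ((\sum_i m x' i * e i x) * (\sum_j m y' j * e j y)) =
        m0 * u x' y' * ((x == x')%:R * (y == y')%:R).
      have [x'S | x'S] := boolP (x' \in S); last by rewrite uS ?x'S // !(mulr0, mul0r).
      have [y'S | y'S] := boolP (y' \in S); last by rewrite uS ?y'S ?orbT // !(mulr0, mul0r).
      by rewrite !Em.
    rewrite (bigD1 x) //= (bigD1 y) //= delta !eqxx !mulr1.
    rewrite [X in _ + X + _]big1 => [|y' ny]; last first.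
      by rewrite delta [y == _]eq_sym (negPf ny) !mulr0.
    rewrite addr0 big1 ?addr0 // => x' nx.
    by rewrite big1 // => y' _; rewrite delta eq_sym (negPf nx) mul0r mulr0.
  rewrite /c; under [RHS]eq_bigr => i _ do
    (under eq_bigr => j _ do rewrite mulr_suml; rewrite exchange_big).
  rewrite [RHS]exchange_big; apply: eq_bigr => x' _ /=.
  under [RHS]eq_bigr => i _ do
    (under eq_bigr => j _ do rewrite mulr_suml; rewrite exchange_big).
  rewrite [RHS]exchange_big; apply: eq_bigr => y' _ /=.
  rewrite big_distrlr mulr_sumr; apply: eq_bigr => i _ /=.
  rewrite mulr_sumr; apply: eq_bigr => j _.
  by rewrite [X in _ * X = _]mulrACA [LHS]mulrA.
have /fin_all_exists[k Ek] (z : 'I_(dim D) * 'I_(dim D)) :=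
  galois_trace_base galM1 (c z.1 z.2).
exists ((\matrix_(i, j) k (i, j)) : 'M_(_, _)) => x y; rewrite tens_evalE.
have uT : u x y = \sum_(g : gal_of {:M}) g (m0 * u (act g^-1%g x) (act g^-1%g y)).
  rewrite -[LHS]mul1r -tr_m0 mulr_suml; apply: eq_bigr => g _.
  by rewrite rmorphM /= -uG -!actM mulVg !act1.
rewrite uT; under [RHS]eq_bigr => g _ do rewrite Ec rmorph_sum.
rewrite exchange_big; apply: eq_bigr => i _ /=.
under [RHS]eq_bigr => g _ do rewrite rmorph_sum.
rewrite exchange_big; apply: eq_bigr => j _ /=.
rewrite mxE -mulr_algl -Ek mulr_suml; apply: eq_bigr => g _.
rewrite !rmorphM.
have eq1 (v : D) z : g (vsval v (act g^-1%g z)) = vsval v z.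
  by case/descent_spaceP: (valP v) => <- _; rewrite -actM mulVg act1.
by rewrite /= !eq1.
Qed.

End DescentTensor.

(** * The coset space and the embeddings of L *)

Section Cosets.

Variables (K : fieldType) (M : splittingFieldType K) (L : {subfield M}).

Local Notation G := 'Gal({:M} / 1).
Local Notation G' := 'Gal({:M} / L).
Local Notation galCoset := (galCoset L).
Local Notation one := (galCoset_one L).
Local Notation lambda := (lambda L).
Local Notation X := {perm galCoset}.

(** Elements of one coset agree on [L], so any representative may be used. *)
Lemma galCoset_emb_mem (A : galCoset) (r : gal_of {:M}) (x : subvs_of L) :
  r \in val A -> galCoset_emb A x = r (val x).
Proof.
case: A => A AG /= rA; rewrite /galCoset_emb /=.
have /rcosetsP[h _ EA] := AG; rewrite EA in rA *.
have fixL g : g \in G' -> g (val x) = val x.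
  by move=> gG; apply: fixed_gal gG (valP x); apply: subvf.
have [g1 g1G ->] := rcosetP (mem_repr_rcoset [group of G'] h).
have [g2 g2G ->] := rcosetP rA.
by rewrite !galM ?memvf // (fixL g1) ?(fixL g2).
Qed.

Lemma val_lambda (g : gal_of {:M}) (A : galCoset) : val (lambda g A) = val A :* g.
Proof. by rewrite permE. Qed.

Lemma lambdaM : {morph lambda : g h / (g * h)%g}.
Proof.
move=> g h; apply/permP=> A; apply: val_inj.
by rewrite permM !val_lambda rcosetM.
Qed.

Lemma lambda1 : lambda 1%g = 1%g.
Proof. by apply/permP => A; apply: val_inj; rewrite val_lambda perm1 rcoset1. Qed.

Lemma mem_lambda_one (g : gal_of {:M}) (A : galCoset) :
  (g \in val A) = (lambda g one == A).
Proof.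
case: A => A AG /=; have /rcosetsP[h _ EA] := AG.
rewrite -val_eqE val_lambda /= {}EA.
apply/idP/eqP => [/rcoset_eqP <- // | <-]; exact: rcoset_refl.
Qed.

Lemma lambda_transitive (A : galCoset) : exists g, lambda g one = A.
Proof.
case: (A) => A0 AG; have /rcosetsP[h _ EA] := AG; exists h.
by apply: val_inj; rewrite val_lambda /= EA.
Qed.

Lemma lambda_one_fix (g : gal_of {:M}) : (lambda g one == one) = (g \in G').
Proof. by rewrite -mem_lambda_one. Qed.

Lemma galCoset_emb_lambda (g : gal_of {:M}) (A : galCoset) x :
  galCoset_emb (lambda g A) x = g (galCoset_emb A x).
Proof.
have [h hA] : exists h, h \in val A.
  by have [h <-] := lambda_transitive A; exists h; rewrite mem_lambda_one.
rewrite (galCoset_emb_mem _ hA) (@galCoset_emb_mem _ (h * g)%g).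
  by rewrite galM ?memvf.
by rewrite val_lambda; rewrite mem_rcoset mulgK.
Qed.

Lemma galCoset_emb_linear (A : galCoset) : linear (galCoset_emb A : subvs_of L -> M).
Proof. by move=> k x y; rewrite /galCoset_emb !linearP. Qed.

Lemma galCoset_embM (A : galCoset) (x y : subvs_of L) :
  galCoset_emb A (x * y) = galCoset_emb A x * galCoset_emb A y.
Proof. by rewrite /galCoset_emb rmorphM. Qed.

Lemma galCoset_emb1 (A : galCoset) : galCoset_emb A (1 : subvs_of L) = 1.
Proof. by rewrite /galCoset_emb !rmorph1. Qed.

Hypothesis galM1 : galois 1 {:M}.

Lemma galois_top_over : galois L {:M}.
Proof. by apply: galoisS galM1; rewrite sub1v subvf. Qed.

(** Independence of the embeddings of [L]: evaluated at the traces to [L] of the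
    elements of [M], a relation becomes one between the automorphisms of [M]. *)
Lemma galCoset_emb_independent (c : galCoset -> M) :
  (forall x : subvs_of L, \sum_A c A * galCoset_emb A x = 0) -> forall A, c A = 0.
Proof.
move=> c0 A; have [g <-] := lambda_transitive A; move: g.
apply: (galois_independent (c := fun g => c (lambda g one))) => m.
have xL : galTrace L {:M} m \in L by rewrite mem_galTrace ?memvf ?galois_top_over.
apply: etrans (c0 (Subvs xL)).
transitivity (\sum_(g : gal_of {:M}) \sum_(A0 : galCoset | g \in val A0) c A0 * g m).
  apply: eq_bigr => g _; rewrite (big_pred1 (lambda g one)) // => B.
  by rewrite mem_lambda_one eq_sym.
rewrite (exchange_big_dep xpredT) //=; apply: eq_bigr => B _.
rewrite -mulr_sumr; congr (_ * _).
have [r rB] := lambda_transitive B.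
have rA : r \in val B by rewrite mem_lambda_one rB.
rewrite (galCoset_emb_mem _ rA) /= rmorph_sum.
have -> : val B = G' :* r by rewrite -rB val_lambda.
rewrite (reindex_inj (mulIg r)) /=.
by apply: eq_big => [h | h _]; rewrite ?galM ?memvf // mem_rcoset mulgK.
Qed.

Lemma card_galCoset : #|{: galCoset}| = \dim L.
Proof.
rewrite card_sig; transitivity #|rcosets G' G|; first by apply: eq_card => A; rewrite inE.
have sG : G' \subset G by apply: galS; apply: sub1v.
apply/eqP; rewrite -(eqn_pmul2l (cardG_gt0 [group of G'])) Lagrange //.
rewrite -(galois_dim galM1) -(galois_dim galois_top_over) dimv1 divn1.
by rewrite divnK // field_dimS // subvf.
Qed.

Lemma regular_card (N : {group X}) : regular_subgroup N -> #|N| = #|{: galCoset}|.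
Proof.
case=> trN freeN; have := card_orbit_stab 'P N one.
by rewrite freeN cards1 muln1 (atransP trN) ?inE // cardsT.
Qed.

(** The elements of a regular subgroup are indexed by where their inverses send
    the base point, as this is what occurs in the action of M[N] on [L]. *)
Lemma regular_point (N : {group X}) : regular_subgroup N ->
  exists f : galCoset -> X, forall A, f A \in N /\
     forall n : X, n \in N -> (n^-1%g one == A) = (n == f A).
Proof.
move=> [trN freeN].
suffices /fin_all_exists : forall A, exists n0 : X, n0 \in N /\
  forall n : X, n \in N -> (n^-1%g one == A) = (n == n0) by [].
move=> A.
have [n nN EA] := atransP2 trN (in_setT one) (in_setT A).
exists n^-1%g; split=> [|m mN]; first by rewrite groupV.
apply/eqP/eqP => [Em | ->]; last by rewrite invgK EA.
have : (n * m)%g \in 'C_N[one | 'P].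
  rewrite inE groupM //=; apply/astab1P; rewrite /= /aperm permM.
  by rewrite [n one](_ : _ = m^-1%g one) ?permKV // Em EA.
by rewrite freeN => /set1P/eqP; rewrite mulg_eq1 => /eqP ->; rewrite invgK.
Qed.

(** An operator on [L] of the form given by M[N] determines its coefficients, up
    to adding those of permutations whose inverses agree at the base point. *)
Lemma gp_action_independent (c c' : X -> M) :
  (forall x : subvs_of L, \sum_n c n * galCoset_emb (n^-1%g one) x =
            \sum_n c' n * galCoset_emb (n^-1%g one) x) ->
  forall A, \sum_(n : X | n^-1%g one == A) c n = \sum_(n : X | n^-1%g one == A) c' n.
Proof.
move=> cc' A; apply/eqP; rewrite -subr_eq0; apply/eqP; move: A.
apply: galCoset_emb_independent => x.
have part (d : X -> M) : \sum_A (\sum_(n : X | n^-1%g one == A) d n) * galCoset_emb A x =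
  \sum_n d n * galCoset_emb (n^-1%g one) x.
  rewrite [RHS](partition_big (fun n : X => n^-1%g one) xpredT) //=.
  by apply: eq_bigr => A _; rewrite mulr_suml; apply: eq_bigr => n /eqP ->.
under eq_bigr => A _ do rewrite mulrBl.
by rewrite sumrB !part cc' subrr.
Qed.

Lemma regular_sum (N : {group X}) (f : galCoset -> X) (c : X -> M) A :
  (f A \in N /\ forall n : X, n \in N -> (n^-1%g one == A) = (n == f A)) ->
  (forall n, n \notin N -> c n = 0) -> \sum_(n : X | n^-1%g one == A) c n = c (f A).
Proof.
move=> [fN Ef] c0; rewrite (bigD1 (f A)) ?Ef ?eqxx //=.
rewrite big1 ?addr0 // => n /andP[nA nf]; apply: c0.
by apply: contra nf => nN; rewrite -Ef.
Qed.

End Cosets.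

(** * The normal closure of a separable extension *)

Section GaloisClosure.

Variables (K : fieldType) (M : splittingFieldType K) (L : {subfield M}).
Hypotheses (sepL : separable 1%VS L) (closL : is_normal_closure L).

(** The conjugates of a primitive element of [L] generate a Galois extension
    containing [L], which minimality identifies with [M]. *)
Lemma normal_closure_galois : galois 1 {:M}.
Proof.
set a := separable_generator 1 L.
have defL : L = <<1; a>>%VS :> {vspace M}.
  exact: eq_adjoin_separable_generator sepL (sub1v L).
have [r _ Er] := normalFieldP (normalFieldf 1) a (memvf a).
pose E : {subfield M} := <<1 & r>>%AS.
have galE : galois 1 E.
  apply/splitting_galoisField; exists (minPoly 1 a); split.
  - exact: minPolyOver.
  - have aL : a \in L by rewrite defL memv_adjoin.
    exact: (separableP sepL).
  - by exists r; rewrite ?Er ?eqpxx.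
have sLE : (L <= E)%VS.
  rewrite defL; apply/FadjoinP; split; first exact: sub1v.
  by rewrite seqv_sub_adjoin // -root_prod_XsubC -Er root_minPoly.
by have [_ _ nE] := and3P galE; rewrite -(closL sLE nE).
Qed.

Local Notation G := 'Gal({:M} / 1).
Local Notation lambda := (lambda L).

Lemma lambda_morphic : {in G &, {morph lambda : g h / (g * h)%g}}.
Proof. by move=> g h _ _; apply: lambdaM. Qed.

Definition lambda_morphism : {morphism G >-> {perm galCoset L}} :=
  Morphism lambda_morphic.

(** The fixed field of the kernel is normal and contains [L], hence is [M]. *)
Lemma injm_lambda : 'injm lambda_morphism.
Proof.
have nsZ : 'ker lambda_morphism <| G := ker_normal _.
have galF := normal_fixedField_galois normal_closure_galois nsZ.
have sLF : (L <= fixedField ('ker lambda_morphism))%VS.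
  apply/subvP => x xL; apply/fixedFieldP; first exact: memvf.
  move=> g /kerP; rewrite gal_full => /(_ isT) /= g1.
  have : g \in 'Gal({:M} / L) by rewrite -lambda_one_fix g1 perm1.
  by move/fixed_gal; apply=> //; apply: subvf.
have [_ _ nF] := and3P galF.
have := gal_fixedField ('ker lambda_morphism)%G.
rewrite /= (closL sLF nF) => <-.
apply/subsetP => g; rewrite gal_kHom ?subvf // => /kHomP_tmp[gid _].
by apply/set1P/eqP/gal_eqP => x _; rewrite gal_id gid ?memvf.
Qed.

Lemma lambda_image : lambda_morphism @* G = lambda @: G.
Proof. by rewrite morphimEdom. Qed.

Lemma atrans_lambda :
  [transitive lambda_morphism @* G, on [set: galCoset L] | 'P].
Proof.
apply/imsetP; exists (galCoset_one L); rewrite ?in_setT //.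
apply/esym/eqP; rewrite eqEsubset subsetT /=; apply/subsetP => A _.
have [g <-] := lambda_transitive A.
by apply/imsetP; exists (lambda g) => //; rewrite (mem_morphim lambda_morphism) ?gal_full.
Qed.

End GaloisClosure.


(** * The algebra M[N]^G *)

Section DescentAlgebra.

Variables (K : fieldType) (M : splittingFieldType K) (L : {subfield M}).

Local Notation galCoset := (galCoset L).
Local Notation lambda := (lambda L).
Local Notation X := {perm galCoset}.

Definition conj_act (g : gal_of {:M}) (n : X) : X := (n ^ lambda g)%g.

Lemma conj_actM g h n : conj_act (g * h)%g n = conj_act h (conj_act g n).
Proof. by rewrite /conj_act lambdaM conjgM. Qed.

Lemma conj_act1 n : conj_act 1%g n = n.
Proof. by rewrite /conj_act lambda1 conjg1. Qed.

Lemma conj_act_mul g m n : conj_act g (m * n)%g = (conj_act g m * conj_act g n)%g.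
Proof. exact: conjMg. Qed.

Lemma conj_actV g m : conj_act g m^-1%g = (conj_act g m)^-1%g.
Proof. exact: conjVg. Qed.

Lemma conj_act_inj g : injective (conj_act g).
Proof. exact: conjg_inj. Qed.

Lemma grpRing_mulE (u v : grpRing L) n :
  grpRing_mul u v n = \sum_a u a * v (n * a^-1)%g.
Proof.
rewrite ffunE; apply: eq_bigr => a _.
rewrite (big_pred1 (n * a^-1)%g) // => b.
by apply/eqP/eqP => [<- | ->]; rewrite ?mulgK ?mulgKV.
Qed.

Lemma grpRing_mulA : associative (@grpRing_mul _ _ L).
Proof.
move=> u v w; apply/ffunP => n; rewrite !grpRing_mulE.
transitivity (\sum_c \sum_a u c * v (a * c^-1)%g * w (n * a^-1)%g).
  apply: eq_bigr => c _; rewrite grpRing_mulE mulr_sumr.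
  rewrite (reindex_inj (mulIg c^-1%g)); apply: eq_bigr => a _.
  by rewrite mulrA invMg invgK mulgA mulgKV.
rewrite exchange_big; apply: eq_bigr => a _.
by rewrite grpRing_mulE mulr_suml.
Qed.

Lemma grpRing_mul1l : left_id (grpRing_one L) (@grpRing_mul _ _ L).
Proof.
move=> u; apply/ffunP => n; rewrite grpRing_mulE (bigD1 1%g) //= ffunE eqxx mul1r.
rewrite invg1 mulg1 big1 ?addr0 // => a /negPf na.
by rewrite ffunE na mul0r.
Qed.

Lemma grpRing_mul1r : right_id (grpRing_one L) (@grpRing_mul _ _ L).
Proof.
move=> u; apply/ffunP => n; rewrite grpRing_mulE (bigD1 n) //= ffunE mulgV eqxx.
rewrite mulr1 big1 ?addr0 // => a /negPf na.
by rewrite ffunE -eq_mulgV1 eq_sym na mulr0.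
Qed.

Lemma grpRing_mulDl : left_distributive (@grpRing_mul _ _ L) +%R.
Proof.
move=> u v w; apply/ffunP => n; rewrite [RHS]ffunE !grpRing_mulE -big_split.
by apply: eq_bigr => a _; rewrite ffunE mulrDl.
Qed.

Lemma grpRing_mulDr : right_distributive (@grpRing_mul _ _ L) +%R.
Proof.
move=> u v w; apply/ffunP => n; rewrite [RHS]ffunE !grpRing_mulE -big_split.
by apply: eq_bigr => a _; rewrite ffunE mulrDr.
Qed.

Lemma grpRing_scaleAl k (u v : grpRing L) :
  k *: grpRing_mul u v = grpRing_mul (k *: u : grpRing L) v.
Proof.
apply/ffunP => n; rewrite ffunE !grpRing_mulE scaler_sumr.
by apply: eq_bigr => a _; rewrite ffunE scalerAl.
Qed.

Lemma grpRing_scaleAr k (u v : grpRing L) :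
  k *: grpRing_mul u v = grpRing_mul u (k *: v : grpRing L).
Proof.
apply/ffunP => n; rewrite ffunE !grpRing_mulE scaler_sumr.
by apply: eq_bigr => a _; rewrite ffunE scalerAr.
Qed.

Variable N : {group X}.

Local Notation D := (descent_space conj_act N).

Lemma grpRing_one_mem : grpRing_one L \in D.
Proof.
apply/descent_spaceP; split=> [g n | n nN].
  by rewrite !ffunE /conj_act -{1}(conj1g (lambda g)) (inj_eq (@conjg_inj _ _)) rmorph_nat.
by rewrite ffunE; case: eqP nN => // ->; rewrite group1.
Qed.

Lemma grpRing_mul_mem u v : u \in D -> v \in D -> grpRing_mul u v \in D.
Proof.
move=> /descent_spaceP[uG uN] /descent_spaceP[vG vN]; apply/descent_spaceP.
split=> [g n | n nN]; rewrite !grpRing_mulE.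
  rewrite rmorph_sum (reindex_inj (@conj_act_inj g)) /=; apply: eq_bigr => a _.
  by rewrite -conj_actV -conj_act_mul uG vG rmorphM.
rewrite big1 // => a _; have [aN | aN] := boolP (a \in N).
  by rewrite vN ?mulr0 // groupMr ?groupV.
by rewrite uN ?mul0r.
Qed.

(** A name of its own for the subspace, so that it can carry the product of
    M[N]. *)
Definition descent_alg := subvs_of D.
HB.instance Definition _ := Vector.on descent_alg.

(** The inclusion in M[N]. *)
Definition dval : descent_alg -> grpRing L := @vsval K _ D.
HB.instance Definition _ := GRing.Linear.on dval.

Lemma dval_inj : injective dval. Proof. exact: val_inj. Qed.

Lemma dval_equi g u n : dval u (conj_act g n) = g (dval u n).
Proof. by case/descent_spaceP: (valP u). Qed.

Lemma dval_supp u n : n \notin N -> dval u n = 0.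
Proof. by case/descent_spaceP: (valP u) => _; apply. Qed.

Definition descent_one : descent_alg := Subvs grpRing_one_mem.
Definition descent_mul (u v : descent_alg) : descent_alg :=
  Subvs (grpRing_mul_mem (valP u) (valP v)).

Fact descent_mulA : associative descent_mul.
Proof. by move=> u v w; apply/dval_inj/grpRing_mulA. Qed.
Fact descent_mul1l : left_id descent_one descent_mul.
Proof. by move=> u; apply/dval_inj/grpRing_mul1l. Qed.
Fact descent_mul1r : right_id descent_one descent_mul.
Proof. by move=> u; apply/dval_inj/grpRing_mul1r. Qed.
Fact descent_mulDl : left_distributive descent_mul +%R.
Proof. by move=> u v w; apply/dval_inj/grpRing_mulDl. Qed.
Fact descent_mulDr : right_distributive descent_mul +%R.
Proof. by move=> u v w; apply/dval_inj/grpRing_mulDr. Qed.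
Fact descent_one_neq0 : descent_one != 0.
Proof.
apply/eqP => /(congr1 dval)/ffunP/(_ 1%g)/eqP.
by rewrite linear0 !ffunE eqxx oner_eq0.
Qed.

HB.instance Definition _ := GRing.Zmodule_isNzRing.Build descent_alg
  descent_mulA descent_mul1l descent_mul1r descent_mulDl descent_mulDr
  descent_one_neq0.

Fact descent_scaleAl k (u v : descent_alg) : k *: (u * v) = (k *: u) * v.
Proof. exact/dval_inj/grpRing_scaleAl. Qed.
HB.instance Definition _ := GRing.Lmodule_isLalgebra.Build K descent_alg
  descent_scaleAl.
Fact descent_scaleAr k (u v : descent_alg) : k *: (u * v) = u * (k *: v).
Proof. exact/dval_inj/grpRing_scaleAr. Qed.
HB.instance Definition _ := GRing.Lalgebra_isAlgebra.Build K descent_alg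
  descent_scaleAr.
HB.instance Definition _ := Algebra_isFalgebra.Build K descent_alg.

Lemma dval1 : dval 1 = grpRing_one L. Proof. by []. Qed.
Lemma dvalM u v : dval (u * v) = grpRing_mul (dval u) (dval v). Proof. by []. Qed.

End DescentAlgebra.

(** * The Hopf algebra M[N]^G and its action on L *)

Section DescentHopf.

Variables (K : fieldType) (M : splittingFieldType K) (L : {subfield M}).

Local Notation galCoset := (galCoset L).
Local Notation one := (galCoset_one L).
Local Notation lambda := (lambda L).
Local Notation X := {perm galCoset}.
Local Notation conj_act := (@conj_act K M L).

Variable N : {group X}.
Hypothesis galM1 : galois 1 {:M}.
Hypothesis normN : lambda_normalized N.

Local Notation H := (descent_alg N).
Local Notation dval := (@dval K M L N).

Lemma conj_act_stable g n : n \in N -> conj_act g n \in N.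
Proof.
move=> nN; rewrite /conj_act memJ_norm //.
by apply: (subsetP normN); apply: imset_f; apply: gal_full.
Qed.

Lemma conj_act_surj g n : exists m, conj_act g m = n.
Proof. exact: act_surjective (@conj_actM _ _ _) (@conj_act1 _ _ _) g n. Qed.

Lemma descent_ext (u v : H) : (forall n, dval u n = dval v n) -> u = v.
Proof. by move=> uv; apply/dval_inj/ffunP. Qed.

Lemma descent_mem (f : {ffun X -> M}) :
  (forall g n, f (conj_act g n) = g (f n)) -> (forall n, n \notin N -> f n = 0) ->
  exists u : H, forall n, dval u n = f n.
Proof.
move=> fG fN; have fD : f \in descent_space conj_act N by apply/descent_spaceP.
by exists (Subvs fD).
Qed.

Lemma dvalP k (u v : H) n : dval (k *: u + v) n = k *: dval u n + dval v n.
Proof. by rewrite linearP !ffunE. Qed.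

(** The inclusion of the tensor square in the functions on N x N; identities
    between tensors are proved after applying it. *)
Definition dval2 := tens_eval dval dval.
HB.instance Definition _ := GRing.Linear.on dval2.

Lemma dval2_inj : injective dval2.
Proof.
apply: (tens_eval_inj galM1 conj_act_surj); [exact: dval_inj| exact: dval_equi|exact: dval_inj].
Qed.

Lemma dval2_ext (s t : tens H H) : (forall x y, dval2 s (x, y) = dval2 t (x, y)) -> s = t.
Proof. by move=> st; apply/dval2_inj/ffunP => [[x y]]. Qed.

Definition diag_val (u : H) : {ffun X * X -> M} :=
  [ffun z => if z.1 == z.2 then dval u z.1 else 0].

Lemma diag_val_linear : linear diag_val.
Proof.
move=> k u v; apply/ffunP => z; rewrite !ffunE.
by case: eqP => _; rewrite ?linearP ?ffunE // scaler0 addr0.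
Qed.
HB.instance Definition _ := GRing.isLinear.Build K _ _ _ diag_val diag_val_linear.

(** The element n |-> n (x) n of M[N] has, for coefficients on pairs, the function
    supported on the diagonal; it comes from a tensor over [K] by descent. *)
Definition descent_comul : 'Hom(H, tens H H) :=
  ((linfun dval2)^-1 \o linfun diag_val)%VF.

Lemma dval2_comul u x y :
  dval2 (descent_comul u) (x, y) = if x == y then dval u x else 0.
Proof.
suffices [t Et] : exists t, dval2 t = diag_val u.
  have E : linfun dval2 (descent_comul u) = diag_val u.
    have Eu : linfun diag_val u = linfun dval2 t by rewrite !lfunE.
    rewrite comp_lfunE Eu limg_lfunVK -?Eu; first by rewrite lfunE.
    by rewrite Eu; apply: memv_img; apply: memvf.
  by rewrite -[dval2 _](lfunE dval2) E ffunE.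
have [||t Et] := descent_tensor_surj galM1 (@conj_actM _ _ L) (@conj_act1 _ _ L)
  conj_act_stable (u := fun x y => if x == y then dval u x else 0).
- by move=> m n /orP[] mN; case: eqP => // mn; rewrite dval_supp // mn.
- move=> g m n; rewrite (inj_eq (@conj_act_inj _ _ _ g)).
  by case: eqP; rewrite ?rmorph0 // dval_equi.
by exists t; apply/ffunP => [[m n]]; rewrite Et ffunE.
Qed.

Lemma dval_mulE (u v : H) n : dval (u * v) n = \sum_a dval u a * dval v (n * a^-1)%g.
Proof. by rewrite dvalM grpRing_mulE. Qed.

(** Sweedler sums of bilinear expressions in the coefficients reduce to sums over
    the diagonal; the counit, the antipode and the action on products are handled
    this way. *)
Lemma tens_lift_comul (F : X -> X -> M) u (f : H -> H -> M) :
  (forall v w, f v w = \sum_x \sum_y F x y * (dval v x * dval w y)) ->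
  tens_lift f (descent_comul u) = \sum_x F x x * dval u x.
Proof.
move=> /tens_lift_ext ->; rewrite tens_lift_sum; apply: eq_bigr => x _.
rewrite tens_lift_sum (bigD1 x) //= big1 ?addr0 => [|y nxy].
  by rewrite tens_lift_mull -tens_evalE dval2_comul eqxx.
by rewrite tens_lift_mull -tens_evalE dval2_comul eq_sym (negPf nxy) mulr0.
Qed.

Lemma descent_comul1 : descent_comul 1 = pure 1 1.
Proof.
apply: dval2_ext => x y; rewrite dval2_comul tens_eval_pure dval1 !ffunE.
case: eqP => [<- | nxy]; first by case: (x == 1%g); rewrite ?mul1r ?mul0r.
case: eqP => [x1 | _]; last by rewrite mul0r.
by case: eqP => [y1 | _]; rewrite ?mulr0 // x1 y1 in nxy *.
Qed.

Lemma dval2_mul s t x y : dval2 (tens_mul s t) (x, y) =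
  \sum_a \sum_b dval2 s (a, b) * dval2 t (x * a^-1, y * b^-1)%g.
Proof.
rewrite tens_eval_lift.
rewrite (@tens_lift_ext _ _ _ _ _ (fun v w =>
  \sum_a \sum_b dval v a * dval w b * dval2 t (x * a^-1, y * b^-1)%g)).
  rewrite tens_lift_sum; apply: eq_bigr => a _.
  rewrite tens_lift_sum; apply: eq_bigr => b _.
  by rewrite tens_lift_mulr -tens_evalE.
move=> v w; rewrite tens_eval_lift.
rewrite (@tens_lift_ext _ _ _ _ _ (fun v' w' => \sum_a \sum_b dval v a * dval w b *
   (dval v' (x * a^-1)%g * dval w' (y * b^-1)%g))).
  rewrite tens_lift_sum; apply: eq_bigr => a _.
  rewrite tens_lift_sum; apply: eq_bigr => b _.
  by rewrite tens_lift_mull -tens_evalE.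
move=> v' w'; rewrite tens_eval_pure !dval_mulE big_distrlr /=.
by apply: eq_bigr => a _; apply: eq_bigr => b _; rewrite mulrACA.
Qed.

Lemma descent_comulM u v :
  descent_comul (u * v) = tens_mul (descent_comul u) (descent_comul v).
Proof.
apply: dval2_ext => x y; rewrite dval2_comul dval2_mul.
under [RHS]eq_bigr => a _.
  rewrite (bigD1 a) //= !dval2_comul eqxx (inj_eq (mulIg _)).
  rewrite big1 ?addr0 => [|b nab]; last first.
    by rewrite dval2_comul eq_sym (negPf nab) mul0r.
  over.
case: eqP => _; last by rewrite big1 // => a _; rewrite mulr0.
exact: dval_mulE.
Qed.

(** Coassociativity is compared on triples: the tensor square is itself a space of
    equivariant functions, for the diagonal action on pairs. *)
Lemma dval3_inj : injective (tens_eval dval2 dval).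
Proof.
apply: (@tens_eval_inj _ _ galM1 _ (fun g z => (conj_act g z.1, conj_act g z.2)))=> [g [x y] | | g t [x y] | ].
- have [x' <-] := conj_act_surj g x; have [y' <-] := conj_act_surj g y.
  by exists (x', y').
- exact: dval2_inj.
- rewrite !tens_evalE /tens_lift rmorph_sum; apply: eq_bigr => i _.
  rewrite rmorph_sum; apply: eq_bigr => j _.
  by rewrite /= !dval_equi linearZ /= rmorphM.
- exact: dval_inj.
Qed.

Lemma descent_comulA u :
  tens_assoc (tens_map id descent_comul (descent_comul u)) =
  tens_map descent_comul id (descent_comul u).
Proof.
apply: dval3_inj; apply/ffunP => [[[x y] z]].
rewrite tens_eval_map.
rewrite (@tens_lift_ext _ _ _ _ _ (fun v w => (x == y)%:R * (dval v x * dval w z))); last first.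
  by move=> v w; rewrite dval2_comul; case: eqP; rewrite ?mul1r ?mul0r.
rewrite tens_lift_mull -tens_evalE dval2_comul.
rewrite /tens_assoc tens_eval_lift.
have E3 (v : H) (s : tens H H) : tens_eval dval2 dval
    (tens_lift (fun (v0 w : H) => pure (pure v v0) w) s) (x, y, z) =
    dval v x * dval2 s (y, z).
  rewrite tens_eval_lift [in RHS]tens_evalE -tens_lift_mull.
  by apply: tens_lift_ext => v' w'; rewrite !tens_eval_pure mulrA.
rewrite (tens_lift_ext _ E3) -(@tens_evalE _ _ _ _ _ _ dval dval2).
rewrite tens_eval_map (@tens_lift_ext _ _ _ _ _ (fun v w => (y == z)%:R * (dval v x * dval w y))); last first.
  by move=> v w; rewrite dval2_comul; case: eqP; rewrite ?mul1r ?mul0r ?mulr0.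
rewrite tens_lift_mull -tens_evalE dval2_comul.
have [-> | nxy] := eqVneq x y; last by rewrite mulr0 mul0r.
by case: eqP => [->|]; rewrite ?mul1r ?mul0r ?mulr0.
Qed.

Lemma descent_cocomm u :
  tens_lift (fun b c => pure c b) (descent_comul u) = descent_comul u.
Proof.
apply: dval2_ext => x y; rewrite tens_eval_lift.
rewrite (@tens_lift_ext _ _ _ _ _ (fun v w => dval v y * dval w x)); last first.
  by move=> v w; rewrite tens_eval_pure mulrC.
rewrite -tens_evalE !dval2_comul eq_sym.
by case: eqP => // ->.
Qed.

(** A [K]-linear retraction of [M] onto [K], used to make the invariant sum of the
    coefficients a scalar in [K]. *)
Definition base_coord (m : M) : K^o := coord [tuple (1 : M)] ord0 m.

Lemma base_coordK (k : K) : base_coord k%:A = k.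
Proof.
rewrite /base_coord linearZ /= (coord_free ord0 ord0).
  by rewrite eqxx /GRing.scale /= mulr1.
by rewrite seq1_free oner_eq0.
Qed.

Definition descent_sum (u : H) : K^o := base_coord (\sum_n dval u n).

Lemma descent_sum_linear : linear descent_sum.
Proof.
move=> k u v; rewrite /descent_sum /base_coord.
have -> : \sum_n dval (k *: u + v) n = k *: (\sum_n dval u n) + \sum_n dval v n.
  rewrite scaler_sumr -big_split; apply: eq_bigr => n _.
  by rewrite linearP !ffunE.
by rewrite linearD linearZ.
Qed.
HB.instance Definition _ := GRing.isLinear.Build K _ _ _ descent_sum descent_sum_linear.

Definition descent_counit : 'Hom(H, K^o) := linfun descent_sum.

Lemma descent_counitE u : (descent_counit u : K)%:A = \sum_n dval u n.
Proof.
rewrite lfunE /= /descent_sum.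
have [|k ->] := galois_fixed_base galM1 (c := \sum_n dval u n).
  move=> g; rewrite rmorph_sum [RHS](reindex_inj (@conj_act_inj _ _ _ g)) /=.
  by apply: eq_bigr => n _; rewrite dval_equi.
by rewrite base_coordK.
Qed.

Lemma scale_counit u (m : M) : (descent_counit u : K) *: m = \sum_n dval u n * m.
Proof. by rewrite -mulr_algl descent_counitE mulr_suml. Qed.

Lemma base_inj (k l : K) : k%:A = l%:A :> M -> k = l.
Proof. by move/(congr1 base_coord); rewrite !base_coordK. Qed.

Lemma descent_counit1 : descent_counit 1 = 1.
Proof.
apply: base_inj; rewrite descent_counitE scale1r dval1.
rewrite (bigD1 1%g) //= ffunE eqxx big1 ?addr0 // => n /negPf n1.
by rewrite ffunE n1.
Qed.

Lemma descent_counitM u v : descent_counit (u * v) = descent_counit u * descent_counit v.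
Proof.
apply: base_inj; rewrite -[RHS]scalerA descent_counitE scale_counit.
under eq_bigr => n _ do rewrite dval_mulE.
rewrite exchange_big; apply: eq_bigr => a _.
rewrite -mulr_sumr descent_counitE; congr (_ * _).
by rewrite [RHS](reindex_inj (mulIg a^-1%g)).
Qed.

Lemma dval_tens_lift (f : H -> H -> H) t n :
  dval (tens_lift f t) n = tens_lift (fun v w => dval (f v w) n) t.
Proof.
rewrite linear_tens_lift /tens_lift sum_ffunE; apply: eq_bigr => i _.
by rewrite sum_ffunE; apply: eq_bigr => j _; rewrite ffunE.
Qed.

Lemma sum_pred1l (n : X) (c : X -> M) : \sum_x (x == n)%:R * c x = c n.
Proof.
rewrite (bigD1 n) //= eqxx mul1r big1 ?addr0 // => x /negPf ->.
by rewrite mul0r.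
Qed.

Lemma descent_comul_counitl u :
  tens_lift (fun b c => (descent_counit b : K) *: c) (descent_comul u) = u.
Proof.
apply: descent_ext => n; rewrite dval_tens_lift.
rewrite (@tens_lift_comul (fun x y => (y == n)%:R)); first exact: sum_pred1l.
move=> v w; rewrite linearZ ffunE scale_counit; apply: eq_bigr => x _.
by rewrite sum_pred1l.
Qed.

Lemma descent_comul_counitr u :
  tens_lift (fun b c => (descent_counit c : K) *: b) (descent_comul u) = u.
Proof.
apply: descent_ext => n; rewrite dval_tens_lift.
rewrite (@tens_lift_comul (fun x y => (x == n)%:R)); first exact: sum_pred1l.
move=> v w; rewrite linearZ ffunE scale_counit exchange_big; apply: eq_bigr => y _.
by rewrite (sum_pred1l n (fun x => dval v x * dval w y)) mulrC.
Qed.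

Lemma inv_val_mem (u : H) : [ffun n => dval u n^-1%g] \in descent_space conj_act N.
Proof.
apply/descent_spaceP; split=> [g n | n nN]; rewrite !ffunE.
  by rewrite -conj_actV dval_equi.
by rewrite dval_supp // groupV.
Qed.

Definition inv_val (u : H) : H := Subvs (inv_val_mem u).

Lemma inv_valE u n : dval (inv_val u) n = dval u n^-1%g.
Proof. by rewrite /dval /= ffunE. Qed.

Lemma inv_val_linear : linear inv_val.
Proof.
by move=> k u v; apply: descent_ext => n; rewrite dvalP !inv_valE dvalP.
Qed.
HB.instance Definition _ := GRing.isLinear.Build K _ _ _ inv_val inv_val_linear.

Definition descent_antipode : 'End(H) := linfun inv_val.

Lemma descent_antipodeE u n : dval (descent_antipode u) n = dval u n^-1%g.
Proof. by rewrite lfunE inv_valE. Qed.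

Lemma descent_counit_scale1 u (n : X) :
  dval ((descent_counit u : K) *: (1 : H)) n = \sum_x (n == 1%g)%:R * dval u x.
Proof.
rewrite linearZ ffunE scale_counit; apply: eq_bigr => x _.
by rewrite [dval 1 n]ffunE mulrC.
Qed.

Lemma descent_antipodel u :
  tens_lift (fun b c => descent_antipode b * c) (descent_comul u) =
  (descent_counit u : K) *: (1 : H).
Proof.
apply: descent_ext => n; rewrite dval_tens_lift descent_counit_scale1.
rewrite (@tens_lift_comul (fun x y => (n == y * x^-1)%g%:R)).
  by apply: eq_bigr => x _; rewrite mulgV.
move=> v w; rewrite dval_mulE (reindex_inj invg_inj) /=; apply: eq_bigr => x _.
rewrite descent_antipodeE invgK.
rewrite -(sum_pred1l (n * x)%g (fun y => dval v x * dval w y)).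
apply: eq_bigr => y _; congr ((nat_of_bool _)%:R * _).
by apply/eqP/eqP => ->; rewrite ?mulgK ?mulgKV.
Qed.

Lemma descent_antipoder u :
  tens_lift (fun b c => b * descent_antipode c) (descent_comul u) =
  (descent_counit u : K) *: (1 : H).
Proof.
apply: descent_ext => n; rewrite dval_tens_lift descent_counit_scale1.
rewrite (@tens_lift_comul (fun x y => (n == y^-1 * x)%g%:R)).
  by apply: eq_bigr => x _; rewrite mulVg.
move=> v w; rewrite dval_mulE; apply: eq_bigr => x _.
rewrite descent_antipodeE invMg invgK.
rewrite -(sum_pred1l (x * n^-1)%g (fun y => dval v x * dval w y)).
apply: eq_bigr => y _; congr ((nat_of_bool _)%:R * _).
apply/eqP/eqP => ->; first by rewrite invMg invgK mulgKV.
by rewrite invMg invgK mulKVg.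
Qed.

Definition descent_hopf : hopfAlgebra K :=
  @HopfAlgebra K H descent_comul descent_counit descent_antipode
    descent_comul1 descent_comulM descent_counit1 descent_counitM
    descent_comulA descent_comul_counitl descent_comul_counitr
    descent_antipodel descent_antipoder.

Definition act_val (u : H) (x : subvs_of L) : M :=
  \sum_n dval u n * galCoset_emb (n^-1%g one) x.

(** For [g] fixing the base point, [g] permutes the terms of the sum; this is why
    the action of M[N]^G preserves [L]. *)
Lemma act_val_gal g u x : lambda g one = one -> g (act_val u x) = act_val u x.
Proof.
move=> g1; rewrite /act_val rmorph_sum [RHS](reindex_inj (@conj_act_inj _ _ _ g)) /=.
apply: eq_bigr => n _; rewrite rmorphM /= dval_equi; congr (_ * _).
rewrite -galCoset_emb_lambda; congr galCoset_emb.
have g1V : (lambda g)^-1%g one = one by apply: (canLR (permK _)).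
by rewrite -conj_actV /conj_act conjgE !permM g1V.
Qed.

Lemma act_val_mem u x : act_val u x \in L.
Proof.
rewrite -(galois_fixedField (galois_top_over L galM1)).
apply/fixedFieldP; first exact: memvf.
by move=> g gG'; apply: act_val_gal; apply/eqP; rewrite lambda_one_fix.
Qed.

Definition act_sub (u : H) (x : subvs_of L) : subvs_of L := Subvs (act_val_mem u x).

Lemma act_sub_linear u : linear (act_sub u).
Proof.
move=> k x y; apply: val_inj; rewrite linearP /= /act_val scaler_sumr -big_split.
by apply: eq_bigr => n _; rewrite galCoset_emb_linear mulrDr scalerAr.
Qed.
HB.instance Definition _ u := GRing.isLinear.Build K _ _ _ (act_sub u) (act_sub_linear u).

Definition act_lfun (u : H) : 'End(subvs_of L) := linfun (act_sub u).

Lemma act_lfun_linear : linear act_lfun.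
Proof.
move=> k u v; apply/lfunP => x; rewrite add_lfunE scale_lfunE !lfunE /=.
apply: val_inj; rewrite linearP /= /act_val scaler_sumr -big_split.
by apply: eq_bigr => n _; rewrite linearP !ffunE mulrDl scalerAl.
Qed.
HB.instance Definition _ := GRing.isLinear.Build K _ _ _ act_lfun act_lfun_linear.

Definition descent_act : 'Hom(H, 'End(subvs_of L)) := linfun act_lfun.

Lemma descent_actE u x : val (descent_act u x) = act_val u x.
Proof. by rewrite lfunE /= lfunE. Qed.


Lemma descent_act1 x : descent_act 1 x = x.
Proof.
apply: val_inj; rewrite descent_actE /act_val (bigD1 1%g) //=.
rewrite [dval 1 _]ffunE eqxx mul1r invg1 perm1 big1 ?addr0 => [|n /negPf n1].
  by rewrite (@galCoset_emb_mem _ _ _ _ 1%g) ?gal_id //= group1.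
by rewrite [dval 1 n]ffunE n1 mul0r.
Qed.

(** Applying a representative [g] of the coset a^-1(G') to the inner sum conjugates
    its index by [lambda g], which is exactly what turns the composite of the
    two coset embeddings into that of the product. *)
Lemma descent_actM u v x : descent_act (u * v) x = descent_act u (descent_act v x).
Proof.
apply: val_inj; rewrite !descent_actE /act_val.
transitivity (\sum_a \sum_n dval u a * dval v (n * a^-1)%g * galCoset_emb (n^-1%g one) x).
  by rewrite exchange_big; apply: eq_bigr => n _; rewrite dval_mulE mulr_suml.
apply: eq_bigr => a _.
have [g Eg] := lambda_transitive (a^-1%g one).
have ga : g \in val (a^-1%g one) by rewrite mem_lambda_one Eg.
rewrite (galCoset_emb_mem _ ga) descent_actE /act_val rmorph_sum mulr_sumr.
rewrite (reindex_inj (mulIg a)) (reindex_inj (@conj_act_inj _ _ _ g)) /=.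
apply: eq_bigr => m _; rewrite mulgK rmorphM /= dval_equi -mulrA; congr (_ * (_ * _)).
rewrite -galCoset_emb_lambda; congr galCoset_emb.
rewrite invMg permM -Eg -permM -conj_actV /conj_act conjgE mulKVg permM //.
Qed.

Lemma descent_act_one u : descent_act u 1 = (descent_counit u : K) *: (1 : subvs_of L).
Proof.
apply: val_inj; rewrite descent_actE /act_val linearZ /= algid1 descent_counitE.
by apply: eq_bigr => n _; rewrite galCoset_emb1 mulr1.
Qed.

Lemma descent_act_mul u x y :
  descent_act u (x * y) =
  tens_lift (fun b c => descent_act b x * descent_act c y) (descent_comul u).
Proof.
apply: val_inj; rewrite descent_actE linear_tens_lift.
rewrite (@tens_lift_comul (fun m n => galCoset_emb (m^-1%g one) x * galCoset_emb (n^-1%g one) y)).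
  by apply: eq_bigr => n _; rewrite galCoset_embM mulrC.
move=> v w; rewrite rmorphM /= !descent_actE big_distrlr.
apply: eq_bigr => m _; apply: eq_bigr => n _.
by rewrite [LHS]mulrACA [LHS]mulrC.
Qed.

Hypothesis regN : regular_subgroup N.

Definition galois_map : tens (subvs_of L) H -> 'End(subvs_of L) :=
  tens_lift (fun (x : subvs_of L) (a : H) =>
    linfun (fun y : subvs_of L => x * descent_act a y)).
HB.instance Definition _ := GRing.Linear.on galois_map.

(** [L] as functions on a point, so that the injectivity of [tens_eval] applies
    to tensors with one factor in [L]. *)
Definition unit_val (x : subvs_of L) : {ffun unit -> M} := [ffun=> val x].

Lemma unit_val_linear : linear unit_val.
Proof. by move=> k x y; apply/ffunP => i; rewrite !ffunE linearP. Qed.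
HB.instance Definition _ := GRing.isLinear.Build K _ _ _ unit_val unit_val_linear.

Lemma unit_val_inj : injective unit_val.
Proof. by move=> x y /ffunP/(_ tt); rewrite !ffunE => /val_inj. Qed.

(** If the operator vanishes, independence of the embeddings kills its coefficient
    at every [l] in [N], and these coefficients determine the tensor. *)
Lemma galois_map_inj : injective galois_map.
Proof.
apply: raddf_inj => t Tt0.
pose t' : tens H (subvs_of L) := (t : 'M_(_, _))^T.
suffices t'0 : t' = 0.
  by apply: (can_inj (@trmxK _ _ _)); rewrite -[LHS]/t' t'0 trmx0.
have inj := @tens_eval_inj _ _ galM1 _ conj_act H dval conj_act_surj (@dval_inj _ _ _ N)
  (@dval_equi _ _ _ N) _ _ unit_val unit_val_inj.
apply: inj; rewrite linear0; apply/ffunP => [[n []]]; rewrite ffunE [RHS]ffunE /=.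
pose c n := tens_lift (fun (a : H) (x : subvs_of L) => dval a n * val x) t'.
suffices c0 m : c m = 0 by apply: etrans (c0 n); apply: tens_lift_ext => a x; rewrite ffunE.
have cN l : l \notin N -> c l = 0.
  move=> lN; rewrite /c /tens_lift big1 // => i _; rewrite big1 // => j _.
  by rewrite dval_supp // mul0r scaler0.
have [mN | /cN //] := boolP (m \in N).
have [f fP] := regular_point regN.
have [_ /(_ m mN)] := fP (m^-1%g one); rewrite eqxx => /esym/eqP Em.
rewrite Em -(regular_sum (fP (m^-1%g one)) cN).
rewrite (@gp_action_independent _ _ _ galM1 c (fun=> 0)) ?big1 // => y.
rewrite [RHS]big1 => [|l _]; last by rewrite mul0r.
transitivity (val (galois_map t y)); last by rewrite Tt0 zero_lfunE.
have E : galois_map t y = tens_lift (fun x a => x * descent_act a y) t.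
  rewrite /galois_map /tens_lift sum_lfunE; apply: eq_bigr => i _.
  by rewrite sum_lfunE; apply: eq_bigr => j _; rewrite scale_lfunE linfun_linearE // => k u v;
     rewrite linearP mulrDr scalerAr.
rewrite E linear_tens_lift tens_lift_swap -/t'.
rewrite (@tens_lift_ext _ _ _ _ _ (fun (a : H) (x : subvs_of L) =>
  \sum_l dval a l * val x * galCoset_emb (l^-1%g one) y)).
  by rewrite tens_lift_sum; apply: eq_bigr => l _; rewrite -tens_lift_mulr.
move=> a x; rewrite rmorphM /= descent_actE /act_val mulr_sumr.
by apply: eq_bigr => l _; rewrite mulrA [val x * _]mulrC.
Qed.

Lemma dim_descent_alg : dim H = \dim L.
Proof.
rewrite -(card_galCoset L galM1) -(regular_card regN).
exact: dim_descent galM1 (@conj_actM _ _ _) (@conj_act1 _ _ _) conj_act_stable.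
Qed.

(** An injective map between spaces of equal dimension (\dim L)^2. *)
Lemma galois_map_bij : bijective galois_map.
Proof.
have ker0 : lker (linfun galois_map) == 0%VS.
  by apply/lker0P => s t; rewrite !lfunE; apply: galois_map_inj.
have full : limg (linfun galois_map) = fullv.
  apply/eqP; rewrite eqEdim subvf limg_dim_eq; last by rewrite (eqP ker0) capv0.
  rewrite !dimvf; rewrite dim_tens dim_descent_alg.
  exact: leqnn.
exists (linfun galois_map)^-1%VF => x.
  by rewrite -[galois_map x](lfunE galois_map) lker0_lfunK.
by rewrite -[LHS](lfunE galois_map) limg_lfunVK // full memvf.
Qed.

Definition descent_hopfGalois : hopfGalois (subvs_of L) :=
  @HopfGalois K (subvs_of L) descent_hopf descent_act
    descent_cocomm descent_act1 descent_actM descent_act_one descent_act_mul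
    galois_map_bij.

Lemma descent_corresponds : gp_corresponds N descent_hopfGalois.
Proof.
exists dval; split=> /=.
- split=> [|u]; first exact: dval_inj.
  split=> [[uN uG] | [a <-]].
    have [|//|a Ea] := @descent_mem u.
      move=> g n; have [nN | nN] := boolP (n \in N); first by rewrite uG ?gal_full.
      rewrite !uN ?rmorph0 //; apply: contra nN => nN.
      by rewrite -[n](conj_act1) -(mulgV g) conj_actM conj_act_stable.
    by exists a; apply/ffunP.
  by split=> [n | g _ n _]; [exact: dval_supp | exact: dval_equi].
- by [].
- split=> [a n n'|a]; last by rewrite -descent_counitE.
  by rewrite -tens_evalE; exact: dval2_comul.
- exact: descent_antipodeE.
- exact: descent_actE.
Qed.

End DescentHopf.

(** * Structures and regular subgroups determine each other *)

Section Correspondence.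

Variables (K : fieldType) (M : splittingFieldType K) (L : {subfield M}).

Local Notation galCoset := (galCoset L).
Local Notation one := (galCoset_one L).
Local Notation X := {perm galCoset}.
Local Notation conj_act := (@conj_act K M L).

Hypothesis galM1 : galois 1 {:M}.

Lemma in_descentP (N : {group X}) (u : grpRing L) : lambda_normalized N ->
  in_descent N u <-> u \in descent_space conj_act N.
Proof.
move=> nN; split=> [[uN uG] | /descent_spaceP[uG uN]]; last by split=> // g _ n _; exact: uG.
apply/descent_spaceP; split=> // g n.
have [nN' | nN'] := boolP (n \in N); first exact: uG g (gal_full g) n nN'.
rewrite !uN ?rmorph0 //; apply: contra nN' => gn.
by rewrite -[n]conj_act1 -(mulgV g) conj_actM conj_act_stable.
Qed.

Section Iso.

Variables (N : {group X}) (normN : lambda_normalized N).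
Variables (Y Y' : hopfGalois (subvs_of L)).

(** Both Hopf algebras embed in M[N] with image M[N]^G, and all the structure is
    read off in M[N]. *)
Lemma gp_corresponds_iso :
  gp_corresponds N Y -> gp_corresponds N Y' -> hg_iso Y Y'.
Proof.
case=> phi [[phiI phiD] [phi1 phiM] [phiC phiE] phiS phiA].
case=> psi [[psiI psiD] [psi1 psiM] [psiC psiE] psiS psiA].
pose f : 'Hom(hg_hopf Y, hg_hopf Y') := ((linfun psi)^-1 \o linfun phi)%VF.
have fE a : psi (f a) = phi a.
  have [b Eb] : exists b, psi b = phi a by apply/psiD/phiD; exists a.
  have Eab : linfun phi a = linfun psi b by rewrite !lfunE.
  rewrite -[LHS](lfunE psi) comp_lfunE Eab limg_lfunVK; first by rewrite lfunE.
  by apply: memv_img; apply: memvf.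
have psiG g a n : psi a (conj_act g n) = g (psi a n).
  have /(in_descentP _ normN)/descent_spaceP[-> //] : in_descent N (psi a).
  by apply/psiD; exists a.
exists f; last first.
  by move=> a x; apply: val_inj; rewrite psiA phiA fE.
have fI : injective f by move=> a b ab; apply: phiI; rewrite -!fE ab.
split.
- pose g := ((linfun phi)^-1 \o linfun psi)%VF.
  have gE b : phi (g b) = psi b.
    have [a Ea] : exists a, phi a = psi b by apply/phiD/psiD; exists b.
    have Eab : linfun psi b = linfun phi a by rewrite !lfunE.
    rewrite -[LHS](lfunE phi) comp_lfunE Eab limg_lfunVK; first by rewrite lfunE.
    by apply: memv_img; apply: memvf.
  by exists g => a; [apply: phiI; rewrite gE fE | apply: psiI; rewrite fE gE].
- by split=> [|a b]; apply: psiI; rewrite ?psiM !fE ?phi1 ?psi1 ?phiM.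
- move=> a; apply: (tens_eval_inj galM1 (@conj_act_surj _ _ _) psiI psiG psiI).
  apply/ffunP => [[n n']]; rewrite tens_eval_map tens_evalE psiC.
  under [RHS]tens_lift_ext => v w do rewrite !fE.
  by rewrite phiC fE.
- move=> a; apply: (@base_inj _ M); rewrite -psiE -phiE.
  by apply: eq_bigr => n _; rewrite fE.
- by move=> a; apply: psiI; apply/ffunP => n; rewrite fE phiS psiS fE.
Qed.

End Iso.

(** [F A] and [F' A] are the elements of [N] and [N'] whose inverses send the base
    point to [A].  Comparing actions on [L], corresponding elements of the two
    Hopf algebras have the same coefficients at [F A] and [F' A] ([phipsi]); comparing
    products, also at the quotients F A (F B)^-1 and F' A (F' B)^-1 ([quo]).  As
    M[N]^G separates the elements of [N], these quotients send the base point to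
    the same place, which says that [F A] and [F' A] have equal inverses. *)
Lemma gp_corresponds_inj (N N' : {group X}) (Y Y' : hopfGalois (subvs_of L)) :
  lambda_normalized N -> regular_subgroup N ->
  lambda_normalized N' -> regular_subgroup N' ->
  gp_corresponds N Y -> gp_corresponds N' Y' -> hg_iso Y Y' -> N = N'.
Proof.
move=> nN rN nN' rN'.
case=> phi [[phiI phiD] [phi1 phiM] _ _ phiA].
case=> psi0 [[psiI psiD] [psi1 psiM] _ _ psiA] [f [_ [_ fM] _ _ _] fA].
have [F FP] := regular_point rN; have [F' F'P] := regular_point rN'.
pose psi a := psi0 (f a).
have phiN a n : n \notin N -> phi a n = 0.
  have [uN _] : in_descent N (phi a) by apply/phiD; exists a.
  exact: uN.
have psiN a n : n \notin N' -> psi a n = 0.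
  have [uN _] : in_descent N' (psi a) by apply/psiD; exists (f a).
  exact: uN.
have phipsi a A : phi a (F A) = psi a (F' A).
  rewrite -(regular_sum (FP A) (phiN a)) -(regular_sum (F'P A) (psiN a)).
  apply: (gp_action_independent galM1) => x.
  by rewrite -phiA -psiA fA.
have sep c : (forall a, \sum_n c n * phi a n = 0) -> forall n, n \in N -> c n = 0.
  move=> c0; apply: (descent_separates (@conj_actM _ _ L) (@conj_act1 _ _ L) (conj_act_stable nN)).
  by move=> u /(in_descentP _ nN)/phiD[a <-].
have phi_sep m n : m \in N -> n \in N -> (forall a, phi a m = phi a n) -> m = n.
  move=> mN nN1 mn; apply/eqP/negPn/negP => nmn.
  suffices /eqP : (m == m)%:R - (m == n)%:R = 0 :> M.
    by rewrite eqxx (negPf nmn) subr0 oner_eq0.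
  apply: (sep (fun x => (x == m)%:R - (x == n)%:R)) mN => a.
  under eq_bigr => x _ do rewrite mulrBl.
  by rewrite sumrB !sum_pred1l mn subrr.
have NF n : n \in N -> n = F (n^-1%g one).
  by move=> nN1; have [_ /(_ n nN1)] := FP (n^-1%g one); rewrite eqxx => /esym/eqP.
have NF' n : n \in N' -> n = F' (n^-1%g one).
  by move=> nN1; have [_ /(_ n nN1)] := F'P (n^-1%g one); rewrite eqxx => /esym/eqP.
have Fpt A : (F A)^-1%g one = A.
  by have [FN /(_ _ FN)] := FP A; rewrite eqxx => /eqP.
have FptN A : F A \in N by case: (FP A).
have FptN' A : F' A \in N' by case: (F'P A).
have sumF (u : X -> M) : (forall n, n \notin N -> u n = 0) -> \sum_n u n = \sum_A u (F A).
  move=> u0; rewrite (partition_big (fun n : X => n^-1%g one) xpredT) //=.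
  by apply: eq_bigr => A _; apply: regular_sum (FP A) u0.
have sumF' (u : X -> M) : (forall n, n \notin N' -> u n = 0) -> \sum_n u n = \sum_A u (F' A).
  move=> u0; rewrite (partition_big (fun n : X => n^-1%g one) xpredT) //=.
  by apply: eq_bigr => A _; apply: regular_sum (F'P A) u0.
(* The coefficient of a product a * b at F A is a combination of the values of
   a, which may be chosen freely on N; compare it with its counterpart at F' A. *)
have quo A B b : phi b (F A * (F B)^-1)%g = psi b (F' A * (F' B)^-1)%g.
  have := sep (fun x => phi b (F A * x^-1)%g - psi b (F' A * (F' (x^-1%g one))^-1)%g).
  move=> /(_ _ (F B) (FptN B)); rewrite Fpt => E; apply/eqP; rewrite -subr_eq0.
  apply/eqP/E => a; under eq_bigr => x _ do rewrite mulrBl.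
  rewrite sumrB [X in _ - X]sumF => [|n nN1]; last by rewrite phiN // mulr0.
  under [X in _ - X]eq_bigr => B' _ do rewrite Fpt phipsi.
  rewrite -[X in _ - X](sumF' (fun x => psi b (F' A * x^-1)%g * psi a x)); last first.
    by move=> n nN1; rewrite (psiN a n nN1) mulr0.
  have := phipsi (a * b) A; rewrite /psi fM phiM psiM !grpRing_mulE => Eab.
  apply/eqP; rewrite subr_eq0; apply/eqP.
  by under eq_bigr => x _ do rewrite mulrC; under [RHS]eq_bigr => x _ do rewrite mulrC.
(* F A (F B)^-1 is itself some F C, whose counterpart F' C has the same
   coefficients as F' A (F' B)^-1. *)
have pt A B : (F A)^-1%g (F B one) = (F' A)^-1%g (F' B one).
  have E : (F A * (F B)^-1)%g = F ((F' A * (F' B)^-1)^-1%g one).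
    apply: phi_sep => [||b]; [by rewrite groupM ?groupV ?FptN | exact: FptN |].
    by rewrite quo phipsi -NF' // groupM ?groupV ?FptN'.
  by rewrite -!permM -[F B]invgK -[F' B]invgK -!invMg E Fpt.
(* At the base point F and F' are 1, so pt shows first that F B and F' B agree
   there, and then that (F A)^-1 and (F' A)^-1 agree everywhere. *)
have F1 : F one = 1%g by rewrite [RHS]NF ?group1 // invg1 perm1.
have F'1 : F' one = 1%g by rewrite [RHS]NF' ?group1 // invg1 perm1.
have Fone B : F B one = F' B one by have := pt one B; rewrite F1 F'1 invg1 !perm1.
have FF' A : F A = F' A.
  apply: invg_inj; apply/permP => P; case: rN => trN _.
  have [n nN1 EP] := atransP2 trN (in_setT one) (in_setT P).
  by have := pt A (n^-1%g one); rewrite -Fone -NF // [n one](_ : _ = P).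
apply/val_inj/setP => n; apply/idP/idP => nN1.
  rewrite (NF n nN1) FF'; exact: FptN'.
rewrite (NF' n nN1) -FF'; exact: FptN.
Qed.

End Correspondence.

Local Open Scope nat_scope.

(** * Counting structures of cyclic type *)

Section Counting.

Variables (p : nat) (p_prime : prime p).
Variables (K : fieldType) (M : splittingFieldType K) (L : {subfield M}).
Hypotheses (sepL : separable 1%VS L) (dimL : \dim L = 2 * p).
Hypothesis closL : is_normal_closure L.

Let galM1 := normal_closure_galois sepL closL.
Local Notation Gamma := (lambda_morphism L @* 'Gal({:M} / 1))%G.
Local Notation cyclic_type X := (@has_type K M L X _ (Zp (2 * p))).

Lemma card_points : #|[set: galCoset L]| = 2 * p.
Proof. by rewrite cardsT (card_galCoset L galM1) dimL. Qed.

Lemma cyclic_regularP (N : {group {perm galCoset L}}) :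
  cyclic_regular Gamma N <->
  [/\ regular_subgroup N, lambda_normalized N & N \isog Zp (2 * p)].
Proof.
have p2 : 0 < 2 * p by rewrite muln_gt0 (prime_gt0 p_prime).
rewrite isog_ZpP //; split=> [crN | [[trN freeN] nN /andP[cycN _]]].
  have oN := cyclic_regular_card card_points (atrans_lambda L) crN.
  have [trN /forallP freeN nNG cycN] := and4P crN; split.
  - by split=> // A; apply/eqP.
  - by rewrite /lambda_normalized -(lambda_image L).
  - by rewrite cycN oN eqxx.
apply/and4P; split=> //; first by apply/forallP => A; rewrite freeN.
by rewrite /= lambda_image.
Qed.

Lemma exists_cyclic_typeP :
  (exists X, cyclic_type X) <-> (exists N, cyclic_regular Gamma N).
Proof.
split=> [[X [N [rN nN _ isoN]]] | [N /cyclic_regularP[rN nN isoN]]].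
  by exists N; apply/cyclic_regularP.
exists (descent_hopfGalois galM1 nN rN), N; split=> //.
exact: descent_corresponds.
Qed.

Lemma count_cyclic_type n : #|[set N | cyclic_regular Gamma N]| = n ->
  card_upto (fun X => cyclic_type X) (@hg_iso K (subvs_of L)) n.
Proof.
move=> <-; set R := [set N | _].
have /fin_all_exists[X corrX] (i : 'I_#|R|) : exists X, gp_corresponds (enum_val i) X.
  have := enum_valP i; rewrite inE => /cyclic_regularP[rN nN _].
  by exists (descent_hopfGalois galM1 nN rN); apply: descent_corresponds.
exists X; split=> [i | i j iso_ij | Y [N [rN nN corrY isoN]]].
- have := enum_valP i; rewrite inE => /cyclic_regularP[rN nN isoN].
  by exists (enum_val i).
- apply: enum_val_inj.
  have := enum_valP i; rewrite inE => /cyclic_regularP[ri ni _].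
  have := enum_valP j; rewrite inE => /cyclic_regularP[rj nj _].
  exact: gp_corresponds_inj (corrX i) (corrX j) iso_ij.
have NR : N \in R by rewrite inE; apply/cyclic_regularP.
exists (enum_rank_in NR N); apply: (gp_corresponds_iso galM1 nN corrY).
by have := corrX (enum_rank_in NR N); rewrite enum_rankK_in.
Qed.

End Counting.

Theorem theorem10 (p : nat) (p_prime : prime p) (p_odd : odd p)
    (K : fieldType) (M : splittingFieldType K) (L : {subfield M})
    (sepL : separable 1%VS L) (dimL : \dim L = 2 * p)
    (closL : is_normal_closure L) :
  let G := 'Gal({:M} / 1)%G in
  let cyclic_type (X : hopfGalois (subvs_of L)) :=
    has_type X (Zp (2 * p)) in
  let case_i m := m %| p.-1 /\ is_faithful_cyclic_sdprod G (2 * p) m in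
  let case_ii m :=
    [/\ ~~ odd m, m %| p.-1 & is_faithful_cyclic_sdprod G p m] in
  let count n := card_upto cyclic_type (@hg_iso K (subvs_of L)) n in
  [/\ (exists X, cyclic_type X) <->
        (exists m, case_i m) \/ (exists m, case_ii m),
      forall m, case_i m -> count 1,
      forall m, case_ii m -> m <> 2 -> count 1
    & case_ii 2 -> count p /\ (G \isog 'D_(2 * p))%g].
Proof.
move=> G cyclic_type case_i case_ii count.
have injl := injm_lambda sepL closL.
have trG := atrans_lambda L.
have cardT := card_points sepL dimL closL.
have p0 := prime_gt0 p_prime.
pose Gamma := (lambda_morphism L @* G)%G.
have countP := count_cyclic_type p_prime sepL dimL closL.
have toGamma n m : is_faithful_cyclic_sdprod G n m -> is_faithful_cyclic_sdprod Gamma n m.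
  exact: faithful_sdprod_isog injl.
have count_i m : case_i m -> #|[set N | cyclic_regular Gamma N]| = 1.
  by case=> mp /toGamma; apply: (card_cyclic_regular_C2p p_prime p_odd cardT trG).
have unpack m : case_ii m -> exists P Q : {group {perm galCoset L}},
    [/\ m %| p.-1, (P ><| Q)%g = Gamma, #|P| = p, #|Q| = m & cyclic Q /\ 'C_Q(P)%g = 1%g].
  case=> _ mp /toGamma[P [Q [defG isoP isoQ cQP]]]; exists P, Q.
  have [m0 _] := p_ndvd_div_pred p_prime mp.
  by move: isoP isoQ; rewrite !isog_ZpP // => /andP[_ /eqP ->] /andP[-> /eqP ->].
have count_ii m : case_ii m -> m <> 2 -> #|[set N | cyclic_regular Gamma N]| = 1.
  move=> /unpack[P [Q [mp defG oP oQ [cycQ cQP]]]].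
  exact: (card_cyclic_regular_Cp p_prime p_odd cardT trG mp defG oP oQ cycQ cQP).
have count_ii2 : case_ii 2 -> #|[set N | cyclic_regular Gamma N]| = p /\ (G \isog 'D_(2 * p))%g.
  move=> /unpack[P [Q [mp defG oP oQ [cycQ cQP]]]]; split.
    exact: (card_cyclic_regular_Dp p_prime p_odd cardT trG mp defG oP oQ cQP).
  apply: (isog_trans (sub_isog (subxx _) injl)).
  exact: (Cp_sdprod_C2_dihedral p_prime p_odd mp defG oP oQ cQP).
have nonempty n : 0 < n -> #|[set N | cyclic_regular Gamma N]| = n -> exists X, cyclic_type X.
  move=> n0 E; apply/(exists_cyclic_typeP p_prime sepL dimL closL).
  have /card_gt0P[N] : 0 < #|[set N | cyclic_regular Gamma N]| by rewrite E.
  by rewrite inE; exists N.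
split=> [|m /count_i/countP // | m ci /(count_ii m ci)/countP // | /count_ii2[/countP]//].
split=> [|[[m ci] | [m ci]]].
- move/(exists_cyclic_typeP p_prime sepL dimL closL) => [N crN].
  case: (cyclic_regular_cases p_prime p_odd cardT trG crN).
    case=> m mp sd; left; exists m; split=> //.
    exact: faithful_sdprod_isog_inv injl sd.
  case=> m /andP[evm mp] sd; right; exists m; split=> //.
  exact: faithful_sdprod_isog_inv injl sd.
- exact: nonempty (count_i m ci).
have [m2 | m2] := eqVneq m 2.
  by rewrite m2 in ci; have [E _] := count_ii2 ci; apply: nonempty E.
by apply: nonempty (count_ii m ci _) => //; apply/eqP.
Qed.
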